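(* Let $f,g,h,k$ be smooth real functions on a real interval $I$ with $h(y)\neq 0$ for all $y\in I$. Consider the Abel equation $$\frac{dv}{dy}=k(y)+f(y)v+g(y)v^2+h(y)v^3 \qquad (A)$$ and the quadratic-cubic extended Liénard equation for $y=y(x)$, $$y''+f(y)(y')^2+k(y)(y')^3+g(y)y'+h(y)=0. \qquad (L)$$ Assume that (A) has a real particular solution $v_p$ satisfying $3h(y)v_p^2+2g(y)v_p+f(y)=0$, i.e. for a fixed choice of sign $\pm$, $$v_p(y)=-\frac{g(y)}{3h(y)}\pm\frac{\sqrt{g^2(y)-3f(y)h(y)}}{3h(y)}.$$ a) If for some constants $S\neq 0$ and $C_0$ the coefficients satisfy $$\frac{g^2(y)}{3h^2(y)}-\frac{f(y)}{h(y)}=\frac{1}{6S\int h(y)\,dy+C_0/3}, \qquad ( * )$$ then the Abel equation (A) is exactly integrable. b) The general solution of (A) with coefficients satisfying $( * )$ is given by $$v(y,S)=\pm\frac{\sqrt{g^2(y)-3f(y)h(y)}}{h(y)}\,\theta(y,S)+v_p(y),$$ where $\theta(y,S)$ is a solution of the algebraic equation $$K_0^{-1}e^{G[\theta(y,S),S]}=\pm\frac{h(y)}{\sqrt{g^2(y)-3f(y)h(y)}},$$ with $K_0^{-1}$ an arbitrary (nonzero) constant of integration. c) The Liénard equation (L) with coefficients satisfying $( * )$ is exactly integrable, and its general solution is given by $$x-x_0=\frac{1}{3}\int\frac{1}{h(y)}\left\{\pm\sqrt{g^2(y)-3f(y)h(y)}\,\left[3\theta(y,S)+1\right]-g(y)\right\}dy,$$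 where $x_0$ is an arbitrary constant of integration. Throughout, the sign $\pm$ is the same one as in $v_p$.
   Context: Primes denote derivatives with respect to $x$; solutions of (L) and (A) are related by $v=1/y'$. The function $e^{G(\theta,S)}$ is defined by $$e^{G(\theta,S)}=\begin{cases}\dfrac{\theta}{\sqrt{\theta^2+\theta+S}}\exp\left[-\dfrac{1}{\sqrt{4S-1}}\arctan\left(\dfrac{1+2\theta}{\sqrt{4S-1}}\right)\right], & S>\tfrac14,\\[2mm] \dfrac{\theta}{1+2\theta}\,e^{1/(1+2\theta)}, & S=\tfrac14,\\[2mm] \dfrac{\theta}{\sqrt{\theta^2+\theta+S}}\exp\left[\dfrac{1}{\sqrt{1-4S}}\,\mathrm{arctanh}\left(\dfrac{1+2\theta}{\sqrt{1-4S}}\right)\right], & S<\tfrac14.\end{cases}$$ For $S<1/4$ the square root or the arctanh may take complex values; the resulting locally constant complex factor is absorbed into $K_0$. A differential equation is called (exactly) integrable if it can be solved by quadratures, i.e. by definite or indefinite integrals (possibly in implicit form). ''General solution'' is meant in the classical sense: a family of solutions depending on as many arbitrary constants as the order of the equation, on domains where all expressions are defined. $\int(\cdot)\,dy$ denotes an antiderivative. *)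

(* Defs.v *)
(* Vanilla Stdlib reals with Coquelicot. *)
From Stdlib Require Import Reals List.
From Coquelicot Require Import Coquelicot.
Open Scope R_scope.

(** * Calculus on a real interval *)

(* Open, closed, half-open or unbounded intervals, but not single points. *)
Definition real_interval (J : R -> Prop) : Prop :=
  (forall a b t, J a -> J b -> a <= t <= b -> J t) /\
  (exists a b, J a /\ J b /\ a < b).

Definition subset (J I : R -> Prop) : Prop := forall t, J t -> I t.

(* [is_derive] with the filter [locally x] replaced by its trace on [J]: the
   usual derivative at interior points of [J], one-sided at endpoints in [J]. *)
Definition is_derive_on (J : R -> Prop) (F : R -> R) (x l : R) : Prop :=
  filterdiff F (within J (locally x)) (fun t => scal t l).

Definition antiderivative_on (J : R -> Prop) (F a : R -> R) : Prop :=
  forall t, J t -> is_derive_on J F t (a t).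

(* [d n] is the [n]-th derivative. *)
Definition smooth_on (J : R -> Prop) (a : R -> R) : Prop :=
  exists d : nat -> R -> R,
    (forall t, J t -> d 0%nat t = a t) /\
    (forall n, antiderivative_on J (d n) (d (S n))).

(** * The function exp(G(theta,S)) *)

(* Principal branches of the square root, logarithm and arctanh at a real
   argument, with values in C. *)
Definition Csqrt_of_R (r : R) : C :=
  if Rlt_dec r 0 then (0, sqrt (- r)) else (sqrt r, 0).

Definition Cln_of_R (r : R) : C :=
  (ln (Rabs r), if Rlt_dec r 0 then PI else 0).

Definition Carctanh_of_R (r : R) : C :=
  ((Cln_of_R (1 + r) - Cln_of_R (1 - r)) / RtoC 2)%C.

Definition Cexponential (z : C) : C :=
  (exp (fst z) * cos (snd z), exp (fst z) * sin (snd z)).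

Definition eG (theta S : R) : C :=
  match total_order_T S (1 / 4) with
  | inright _ (* S > 1/4 *) =>
      RtoC (theta / sqrt (theta ^ 2 + theta + S) *
            exp (- (1 / sqrt (4 * S - 1) *
                    atan ((1 + 2 * theta) / sqrt (4 * S - 1)))))
  | inleft (right _) (* S = 1/4 *) =>
      RtoC (theta / (1 + 2 * theta) * exp (1 / (1 + 2 * theta)))
  | inleft (left _) (* S < 1/4 *) =>
      (RtoC theta / Csqrt_of_R (theta ^ 2 + theta + S) *
       Cexponential (RtoC (1 / sqrt (1 - 4 * S)) *
                     Carctanh_of_R ((1 + 2 * theta) / sqrt (1 - 4 * S))))%C
  end.

(* For S > 1/4 this always holds; for S = 1/4 it says 1 + 2 theta <> 0; for
   S < 1/4 it excludes the zeros of the square root, which are also the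
   singularities (argument 1 or -1) of the arctanh. *)
Definition eG_defined (theta S : R) : Prop := theta ^ 2 + theta + S <> 0.

(** * The two differential equations *)

Definition abel_solution (f g h k : R -> R) (I J : R -> Prop) (v : R -> R)
  : Prop :=
  subset J I /\
  forall y, J y ->
    is_derive_on J v y (k y + f y * v y + g y * v y ^ 2 + h y * v y ^ 3).

(* [y1] is the derivative of [y]. *)
Definition lienard_solution (f g h k : R -> R) (I X : R -> Prop)
  (y y1 : R -> R) : Prop :=
  exists y2 : R -> R, forall x, X x ->
    I (y x) /\
    is_derive_on X y x (y1 x) /\
    is_derive_on X y1 x (y2 x) /\
    y2 x + f (y x) * y1 x ^ 2 + k (y x) * y1 x ^ 3 + g (y x) * y1 x + h (y x)
      = 0.

(* Solutions in the domain of the substitution v = 1 / y'.  Since h never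
   vanishes, the zeros of y' along any solution are isolated. *)
Definition lienard_regular_solution (f g h k : R -> R) (I X : R -> Prop)
  (y : R -> R) : Prop :=
  exists y1, lienard_solution f g h k I X y y1 /\ forall x, X x -> y1 x <> 0.

(** * Integrability by quadratures *)

(* [quadrature base I J w]: on the interval [J] the function [w] of one
   variable is obtained from the coefficient functions [base], which live on
   [I], the independent variable and constants by finitely many arithmetic
   operations, elementary functions, indefinite integrals, and resolutions of
   an implicit relation F(w(t)) = q(t) with F and q already obtained and F'
   without zeros.  F is then strictly monotone on the interval [J'], so that
   the relation determines [w]. *)
Inductive quadrature (base : list (R -> R)) (I : R -> Prop)
  : (R -> Prop) -> (R -> R) -> Prop :=
| quad_base J c : In c base -> subset J I -> quadrature base I J c
| quad_const J r : quadrature base I J (fun _ => r)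
| quad_var J : quadrature base I J (fun t => t)
| quad_ext J a b :
    (forall t, J t -> a t = b t) -> quadrature base I J a ->
    quadrature base I J b
| quad_plus J a b :
    quadrature base I J a -> quadrature base I J b ->
    quadrature base I J (fun t => a t + b t)
| quad_mult J a b :
    quadrature base I J a -> quadrature base I J b ->
    quadrature base I J (fun t => a t * b t)
| quad_inv J a :
    (forall t, J t -> a t <> 0) -> quadrature base I J a ->
    quadrature base I J (fun t => / a t)
| quad_sqrt J a :
    (forall t, J t -> 0 < a t) -> quadrature base I J a ->
    quadrature base I J (fun t => sqrt (a t))
| quad_exp J a :
    quadrature base I J a -> quadrature base I J (fun t => exp (a t))
| quad_ln J a :
    (forall t, J t -> 0 < a t) -> quadrature base I J a ->
    quadrature base I J (fun t => ln (a t))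
| quad_atan J a :
    quadrature base I J a -> quadrature base I J (fun t => atan (a t))
| quad_integral J a A :
    antiderivative_on J A a -> quadrature base I J a ->
    quadrature base I J A
| quad_implicit J J' F dF w :
    real_interval J' ->
    antiderivative_on J' F dF -> (forall z, J' z -> dF z <> 0) ->
    quadrature base I J' F ->
    (forall t, J t -> J' (w t)) ->
    quadrature base I J (fun t => F (w t)) ->
    quadrature base I J w.

(* [Sol J w]: [w] is a solution on the interval [J] of the equation whose
   coefficient functions are [base]. *)
Definition exactly_integrable (base : list (R -> R)) (I : R -> Prop)
  (Sol : (R -> Prop) -> (R -> R) -> Prop) : Prop :=
  forall J w, real_interval J -> Sol J w -> quadrature base I J w.

(** * The solution formulas; [sigma] is the sign, 1 or -1 *)

Definition root_disc (f g h : R -> R) (y : R) : R :=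
  sqrt (g y ^ 2 - 3 * f y * h y).

Definition abel_formula (sigma : R) (f g h vp : R -> R) (theta y : R) : R :=
  sigma * (root_disc f g h y / h y) * theta + vp y.

(* A continuous branch of the algebraic equation.  The constant [K0] is complex
   because it has to absorb the locally constant complex factor of [eG] when
   S < 1/4; [theta] is always real. *)
Definition theta_branch (sigma S : R) (f g h : R -> R) (J : R -> Prop)
  (K0 : C) (theta : R -> R) : Prop :=
  continuous_on J theta /\
  forall y, J y ->
    eG_defined (theta y) S /\
    (/ K0 * eG (theta y) S)%C = RtoC (sigma * (h y / root_disc f g h y)).

Definition abel_family (sigma S : R) (f g h vp : R -> R) (J : R -> Prop)
  (v : R -> R) : Prop :=
  exists (K0 : C) (theta : R -> R),
    K0 <> RtoC 0 /\
    theta_branch sigma S f g h J K0 theta /\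
    forall y, J y -> v y = abel_formula sigma f g h vp (theta y) y.

(* The phase points (y, v) at which the algebraic equation makes sense: the
   theta such that v = abel_formula theta y lies in the domain of [eG], and
   [eG] does not vanish there. *)
Definition abel_admissible (sigma S : R) (f g h vp : R -> R) (y v : R)
  : Prop :=
  exists theta,
    v = abel_formula sigma f g h vp theta y /\
    theta <> 0 /\ eG_defined theta S.

Definition lienard_integrand (sigma : R) (f g h : R -> R) (theta y : R) : R :=
  1 / h y * (sigma * root_disc f g h y * (3 * theta + 1) - g y).

(* [y] is a continuous solution of the implicit equation
   x - x0 = (1/3) P(y), with [P] an antiderivative of the integrand.  A third
   of the integrand is v = 1 / y', hence it must not vanish. *)
Definition lienard_family (sigma S : R) (f g h : R -> R) (I X : R -> Prop)
  (y : R -> R) : Prop :=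
  exists (K0 : C) (x0 : R) (J : R -> Prop) (theta P : R -> R),
    K0 <> RtoC 0 /\
    real_interval J /\ subset J I /\
    theta_branch sigma S f g h J K0 theta /\
    antiderivative_on J P
      (fun t => lienard_integrand sigma f g h (theta t) t) /\
    continuous_on X y /\
    forall x, X x ->
      J (y x) /\
      lienard_integrand sigma f g h (theta (y x)) (y x) <> 0 /\
      x - x0 = 1 / 3 * P (y x).

Definition near_in (I : R -> Prop) (y0 delta : R) : R -> Prop :=
  fun y => I y /\ Rabs (y - y0) < delta.

(* Main.v *)
Require Import Defs.
From Stdlib Require Import Reals List.
From Stdlib Require Import Lra Psatz Classical ClassicalEpsilon.
From Coquelicot Require Import Coquelicot.
Open Scope R_scope.

(* Put [rho = 3 vp + g/h], which is [sigma sqrt(g^2 - 3fh) / h].  Condition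
   (star) says [rho^2 = 3 / (6 S int h + C0/3)], hence [rho' = - S h rho^3], and therefore
   [v = rho theta + vp] turns (A) into the separable equation
   [theta' = h rho^2 theta (theta^2 + theta + S)].  Since
   [d e^G / d theta = S e^G / (theta (theta^2 + theta + S))], the product
   [e^G(theta) rho] is constant along solutions; this is the algebraic equation
   of b).  Solutions meeting a zero of the cubic are constant in [theta] by
   uniqueness, and the others are obtained by inverting the logarithm of [e^G].
   For (L), the inverse function [x(y)] has derivative [v(y)], so that (L) is (A)
   followed by one integration and one inversion. *)

Set Bullet Behavior "Strict Subproofs".

(** * Calculus relative to an interval *)

(** Three points behind these steps. The intervals may contain endpoints, so derivatives are
    relative to [J], one-sided at an endpoint, and the usual theorems are carried over to this
    notion. The equation separates by homogeneity. Expanded at [vp], the right-hand side of (A) has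
    no linear term, by the root condition on [vp], and its quadratic coefficient is
    [3 h vp + g = h rho]. So [u = v - vp] satisfies [u' = h (rho u^2 + u^3)], of degree 3 in [u] and
    [rho] together, exactly like [rho' = - S h rho^3]; the ratio [theta = u / rho] therefore has a
    derivative [h rho^2] times a function of [theta] alone. For [S < 1/4] the function [eG] is
    complex and its phase may jump at the singularities. It is replaced by a real function [E] with
    the same logarithmic derivative, of which [eG] is a constant complex multiple on each component
    of its domain. By the intermediate value theorem a continuous branch never leaves its component,
    so that one [K0] absorbs the multiple. *)

Definition cont_at (J : R -> Prop) (F : R -> R) (x : R) : Prop :=
  filterlim F (within J (locally x)) (locally (F x)).

Lemma within_locally_iff (J P : R -> Prop) (x : R) :
  within J (locally x) P <->
  exists d, 0 < d /\ forall t, J t -> Rabs (t - x) < d -> P t.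
Proof.
split.
- intros [d Hd]. exists d. split. apply cond_pos.
  intros t Jt Ht. apply Hd; auto.
- intros [d [dp Hd]]. exists (mkposreal d dp). intros t Ht Jt. apply Hd; auto.
Qed.

Lemma cont_at_iff (J : R -> Prop) (F : R -> R) (x : R) :
  cont_at J F x <->
  forall e, 0 < e ->
  exists d, 0 < d /\ forall t, J t -> Rabs (t - x) < d -> Rabs (F t - F x) < e.
Proof.
unfold cont_at. rewrite filterlim_locally. split.
- intros K e ep. apply within_locally_iff. exact (K (mkposreal e ep)).
- intros K e. apply within_locally_iff. exact (K e (cond_pos e)).
Qed.

Lemma cont_at_continuous_on (J : R -> Prop) (F : R -> R) :
  (forall x, J x -> cont_at J F x) -> continuous_on J F.
Proof. auto. Qed.

Lemma cont_at_id J x : cont_at J (fun t => t) x.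
Proof. apply cont_at_iff. intros e ep. exists e. auto. Qed.

Lemma cont_at_const J c x : cont_at J (fun _ => c) x.
Proof. apply filterlim_const. Qed.

Lemma cont_at_plus J F G x :
  cont_at J F x -> cont_at J G x -> cont_at J (fun t => F t + G t) x.
Proof.
intros HF HG. apply (filterlim_comp_2 F G Rplus HF HG).
exact (filterlim_plus (F x) (G x)).
Qed.

Lemma cont_at_mult J F G x :
  cont_at J F x -> cont_at J G x -> cont_at J (fun t => F t * G t) x.
Proof.
intros HF HG. apply (filterlim_comp_2 F G Rmult HF HG).
exact (filterlim_mult (F x) (G x)).
Qed.

Lemma cont_at_inv J F x :
  cont_at J F x -> F x <> 0 -> cont_at J (fun t => / F t) x.
Proof.
intros HF H0. apply (filterlim_comp _ _ _ F Rinv _ _ _ HF).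
exact (continuous_Rinv _ H0).
Qed.

Lemma cont_at_comp J X F G x :
  (forall t, J t -> X (G t)) -> cont_at X F (G x) -> cont_at J G x ->
  cont_at J (fun t => F (G t)) x.
Proof.
rewrite !cont_at_iff. intros JX HF HG e ep.
destruct (HF e ep) as [d [dp Hd]]. destruct (HG d dp) as [d' [dp' Hd']].
exists d'. split; auto.
Qed.

Lemma cont_at_ext J F G x :
  J x -> (forall t, J t -> F t = G t) -> cont_at J F x -> cont_at J G x.
Proof.
rewrite !cont_at_iff. intros Jx E HF e ep.
destruct (HF e ep) as [d [dp Hd]]. exists d. split; auto.
intros t Jt Ht. rewrite <- !E; auto.
Qed.

Lemma cont_at_subset J I F x :
  subset J I -> cont_at I F x -> cont_at J F x.
Proof.
rewrite !cont_at_iff. intros JI HF e ep.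
destruct (HF e ep) as [d [dp Hd]]. exists d. split; auto.
Qed.

Lemma continuous_of_cont_at (F : R -> R) x :
  cont_at (fun _ => True) F x -> continuous F x.
Proof.
rewrite cont_at_iff. intros H. apply filterlim_locally. intros e.
destruct (H e (cond_pos e)) as [d [dp Hd]].
exists (mkposreal d dp). intros t Ht. apply Hd; auto.
Qed.

Lemma is_derive_on_iff (J : R -> Prop) (F : R -> R) (x l : R) :
  J x ->
  is_derive_on J F x l <->
  forall e, 0 < e ->
  exists d, 0 < d /\ forall t, J t -> Rabs (t - x) < d ->
    Rabs (F t - F x - l * (t - x)) <= e * Rabs (t - x).
Proof.
intros Jx. split.
- intros [_ K] e ep.
  assert (L : is_filter_lim (within J (locally x)) x).
  { intros P HP. apply filter_le_within; auto. }
  specialize (K x L (mkposreal e ep)). apply within_locally_iff in K.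
  destruct K as [d [dp Hd]]. exists d. split; auto.
  intros t Jt Ht. specialize (Hd t Jt Ht). rewrite (Rmult_comm l). exact Hd.
- intros K. split. apply (is_linear_scal_l (K := R_AbsRing) l).
  intros x0 L.
  (* [filterdiff] asks for the estimate at every limit of the filter. Since [x] itself lies in [J],
     every limit has [x] in all its neighbourhoods, which leaves only [x]. *)
  assert (x0 = x).
  { apply NNPP. intros N. assert (p : 0 < Rabs (x - x0)) by (apply Rabs_pos_lt; lra).
    specialize (L (ball x0 (mkposreal _ p)) (locally_ball _ _)).
    apply locally_singleton in L. specialize (L Jx).
    unfold ball in L; simpl in L. unfold AbsRing_ball, minus, plus, opp, abs in L; simpl in L.
    unfold Rminus in L. lra. }
  subst x0. intros e. apply within_locally_iff.
  destruct (K e (cond_pos e)) as [d [dp Hd]]. exists d. split; auto.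
  intros t Jt Ht. specialize (Hd t Jt Ht). rewrite (Rmult_comm l) in Hd. exact Hd.
Qed.

(* Caratheodory's form of differentiability, which turns the calculus rules
   into the corresponding rules for continuity. *)
Lemma is_derive_on_slope (J : R -> Prop) (F : R -> R) (x l : R) :
  J x ->
  is_derive_on J F x l <->
  exists phi, phi x = l /\ cont_at J phi x /\
    forall t, J t -> F t - F x = phi t * (t - x).
Proof.
intros Jx. rewrite is_derive_on_iff by exact Jx. split.
- intros K.
  exists (fun t => if Req_EM_T t x then l else (F t - F x) / (t - x)).
  assert (E : (if Req_EM_T x x then l else (F x - F x) / (x - x)) = l)
    by (destruct (Req_EM_T x x); lra).
  repeat split; auto.
  + apply cont_at_iff. rewrite E. intros e ep.
    destruct (K (e / 2)) as [d [dp Hd]]. lra. exists d. split; auto.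
    intros t Jt Ht. destruct (Req_EM_T t x) as [_|N].
    { rewrite Rminus_diag_eq, Rabs_R0; auto. }
    specialize (Hd t Jt Ht).
    assert (p : 0 < Rabs (t - x)) by (apply Rabs_pos_lt; lra).
    replace ((F t - F x) / (t - x) - l) with ((F t - F x - l * (t - x)) / (t - x))
      by (field; lra).
    unfold Rdiv. rewrite Rabs_mult, Rabs_inv.
    apply (Rmult_lt_reg_r (Rabs (t - x))); auto.
    rewrite Rmult_assoc, Rinv_l by lra. nra.
  + intros t Jt. destruct (Req_EM_T t x) as [->|N]. ring. field. lra.
- intros [phi [E [C K]]] e ep. apply cont_at_iff with (e := e) in C; auto.
  destruct C as [d [dp Hd]]. exists d. split; auto.
  intros t Jt Ht. rewrite K by auto.
  replace (phi t * (t - x) - l * (t - x)) with ((phi t - phi x) * (t - x))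
    by (rewrite E; ring).
  rewrite Rabs_mult. apply Rmult_le_compat_r. apply Rabs_pos. left; auto.
Qed.

Lemma is_derive_on_ext J F G x l :
  J x -> (forall t, J t -> F t = G t) -> is_derive_on J F x l ->
  is_derive_on J G x l.
Proof.
intros Jx E. rewrite !is_derive_on_slope by auto.
intros [phi [K1 [K2 K3]]]. exists phi. repeat split; auto.
intros t Jt. rewrite <- !E; auto.
Qed.

Lemma is_derive_on_eq J F G x l m :
  J x -> is_derive_on J F x l -> (forall t, J t -> F t = G t) -> l = m ->
  is_derive_on J G x m.
Proof. intros Jx D E <-. exact (is_derive_on_ext J F G x l Jx E D). Qed.

Lemma is_derive_on_subset J I F x l :
  subset J I -> J x -> is_derive_on I F x l -> is_derive_on J F x l.
Proof.
intros JI Jx. rewrite !is_derive_on_slope by auto.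
intros [phi [K1 [K2 K3]]]. exists phi. repeat split; auto.
apply (cont_at_subset J I); auto.
Qed.

Lemma is_derive_on_cont J F x l :
  J x -> is_derive_on J F x l -> cont_at J F x.
Proof.
intros Jx. rewrite is_derive_on_slope by auto. intros [phi [K1 [K2 K3]]].
apply cont_at_ext with (fun t => F x + phi t * (t + - x)); auto.
- intros t Jt. specialize (K3 t Jt). unfold Rminus in K3. lra.
- repeat first [apply cont_at_plus | apply cont_at_mult | apply cont_at_const
    | apply cont_at_id | exact K2].
Qed.

Lemma is_derive_on_const J c x : J x -> is_derive_on J (fun _ => c) x 0.
Proof.
intros Jx. apply is_derive_on_slope; auto. exists (fun _ => 0).
repeat split. apply cont_at_const. intros; ring.
Qed.

Lemma is_derive_on_id J x : J x -> is_derive_on J (fun t => t) x 1.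
Proof.
intros Jx. apply is_derive_on_slope; auto. exists (fun _ => 1).
repeat split. apply cont_at_const. intros; ring.
Qed.

Lemma is_derive_on_plus J F G x l m :
  J x -> is_derive_on J F x l -> is_derive_on J G x m ->
  is_derive_on J (fun t => F t + G t) x (l + m).
Proof.
intros Jx. rewrite !is_derive_on_slope by auto.
intros [p [p1 [p2 p3]]] [q [q1 [q2 q3]]]. exists (fun t => p t + q t).
repeat split. congruence. apply cont_at_plus; auto.
intros t Jt. specialize (p3 t Jt). specialize (q3 t Jt). lra.
Qed.

Lemma is_derive_on_mult J F G x l m :
  J x -> is_derive_on J F x l -> is_derive_on J G x m ->
  is_derive_on J (fun t => F t * G t) x (l * G x + F x * m).
Proof.
intros Jx DF DG. pose proof (is_derive_on_cont _ _ _ _ Jx DG) as CG.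
revert DF DG. rewrite !is_derive_on_slope by auto.
intros [p [p1 [p2 p3]]] [q [q1 [q2 q3]]].
exists (fun t => p t * G t + F x * q t). repeat split. congruence.
- apply cont_at_plus; apply cont_at_mult; auto. apply cont_at_const.
- intros t Jt. specialize (p3 t Jt). specialize (q3 t Jt).
  replace (F t * G t - F x * G x) with ((F t - F x) * G t + F x * (G t - G x)) by ring.
  rewrite p3, q3. ring.
Qed.

Lemma is_derive_on_scal J F x c l :
  J x -> is_derive_on J F x l -> is_derive_on J (fun t => c * F t) x (c * l).
Proof.
intros Jx D. replace (c * l) with (0 * F x + c * l) by ring.
apply (is_derive_on_mult J (fun _ => c)); auto. apply is_derive_on_const; auto.
Qed.

Lemma is_derive_on_comp J X F G x l m :
  J x -> (forall t, J t -> X (G t)) ->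
  is_derive_on X F (G x) m -> is_derive_on J G x l ->
  is_derive_on J (fun t => F (G t)) x (m * l).
Proof.
intros Jx JX DF DG. pose proof (is_derive_on_cont _ _ _ _ Jx DG) as CG.
revert DF DG. rewrite !is_derive_on_slope by auto.
intros [p [p1 [p2 p3]]] [q [q1 [q2 q3]]].
exists (fun t => p (G t) * q t). repeat split. congruence.
- apply cont_at_mult; auto. apply (cont_at_comp J X); auto.
- intros t Jt. rewrite p3, q3 by auto. ring.
Qed.

Lemma is_derive_is_derive_on J (F : R -> R) x l :
  J x -> is_derive F x l -> is_derive_on J F x l.
Proof.
intros Jx D. apply (is_derive_on_subset J (fun _ => True)). easy. auto.
apply is_derive_on_iff. easy. intros e ep. destruct D as [_ D].
destruct (D x (fun P H => H) (mkposreal e ep)) as [d Hd].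
exists d. split. apply cond_pos. intros t _ Ht. specialize (Hd t Ht).
rewrite (Rmult_comm l). exact Hd.
Qed.

Lemma is_derive_on_is_derive J (F : R -> R) x l d :
  0 < d -> (forall t, Rabs (t - x) < d -> J t) ->
  is_derive_on J F x l -> is_derive F x l.
Proof.
intros dp HJ D. assert (Jx : J x).
{ apply HJ. rewrite Rminus_diag_eq, Rabs_R0; auto. }
split. apply (is_linear_scal_l (K := R_AbsRing) l).
intros x0 L. apply (is_filter_lim_locally_unique (V := R_NormedModule) x x0) in L. subst x0. intros e.
destruct (proj1 (is_derive_on_iff J F x l Jx) D e (cond_pos e)) as [d1 [dp1 Hd1]].
assert (q : 0 < Rmin d d1) by (apply Rmin_pos; auto).
exists (mkposreal _ q). intros t Ht.
assert (Ht' : Rabs (t - x) < Rmin d d1) by exact Ht.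
assert (M1 := Rmin_l d d1). assert (M2 := Rmin_r d d1).
specialize (Hd1 t). rewrite (Rmult_comm l) in Hd1. apply Hd1.
apply HJ. lra. lra.
Qed.

Lemma is_derive_on_inv J F x l :
  J x -> is_derive_on J F x l -> F x <> 0 ->
  is_derive_on J (fun t => / F t) x (- l / F x ^ 2).
Proof.
intros Jx D N. replace (- l / F x ^ 2) with (- / F x ^ 2 * l) by (field; auto).
apply (is_derive_on_comp J (fun _ => True) Rinv); auto.
apply is_derive_is_derive_on; auto.
replace (- / F x ^ 2) with (- 1 / F x ^ 2) by (field; auto).
apply (is_derive_inv (fun t => t)); auto. apply @is_derive_id.
Qed.

(* [F o w = q] with [w] merely continuous and [F'] nonzero: [w] is
   differentiable because the slope of [F] can be divided out. *)
Lemma is_derive_on_implicit J X F w q x m l :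
  J x -> (forall t, J t -> X (w t)) -> cont_at J w x ->
  is_derive_on X F (w x) m -> m <> 0 ->
  (forall t, J t -> F (w t) = q t) -> is_derive_on J q x l ->
  is_derive_on J w x (l / m).
Proof.
intros Jx JX C DF m0 E DQ.
revert DF DQ. rewrite (is_derive_on_slope X), (is_derive_on_slope J q) by auto.
intros [p [p1 [p2 p3]]] [r [r1 [r2 r3]]].
assert (C2 : cont_at J (fun t => p (w t)) x) by (apply (cont_at_comp J X); auto).
assert (C3 : cont_at J (fun t => r t * / p (w t)) x).
{ apply cont_at_mult; auto. apply cont_at_inv; auto. congruence. }
apply is_derive_on_iff; auto. intros e ep.
destruct (proj1 (cont_at_iff _ _ _) C3 e ep) as [d1 [dp1 Hd1]].
(* Closer than [Rabs m] to its value [m] at [w x], the slope of [F] cannot vanish. *)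
destruct (proj1 (cont_at_iff _ _ _) C2 (Rabs m)) as [d2 [dp2 Hd2]].
{ apply Rabs_pos_lt; auto. }
exists (Rmin d1 d2). split. apply Rmin_pos; auto.
intros t Jt Ht. assert (M1 := Rmin_l d1 d2). assert (M2 := Rmin_r d1 d2).
specialize (Hd1 t Jt ltac:(lra)). specialize (Hd2 t Jt ltac:(lra)).
assert (N : p (w t) <> 0).
{ intros Z. rewrite Z, p1 in Hd2. unfold Rminus in Hd2.
  rewrite Rplus_0_l, Rabs_Ropp in Hd2. lra. }
specialize (p3 (w t) (JX t Jt)). specialize (r3 t Jt).
rewrite !E in p3 by auto. rewrite r3 in p3.
replace (w t - w x) with (r t * / p (w t) * (t - x))
  by (apply (Rmult_eq_reg_l (p (w t))); auto; rewrite <- p3; field; auto).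
replace (r t * / p (w t) * (t - x) - l / m * (t - x)) with
  ((r t * / p (w t) - r x * / p (w x)) * (t - x))
  by (rewrite r1, p1; field; auto).
rewrite Rabs_mult. apply Rmult_le_compat_r. apply Rabs_pos. lra.
Qed.

(** * Intermediate values and mean values relative to an interval *)

Definition clamp (a b t : R) : R := Rmax a (Rmin b t).

Lemma clamp_range a b t : a <= b -> a <= clamp a b t <= b.
Proof.
intros. unfold clamp, Rmax, Rmin.
destruct (Rle_dec b t); destruct Rle_dec; lra.
Qed.

Lemma clamp_id a b t : a <= t <= b -> clamp a b t = t.
Proof.
intros. unfold clamp, Rmax, Rmin.
destruct (Rle_dec b t); destruct Rle_dec; lra.
Qed.

Lemma clamp_contract a b t x : a <= b ->
  Rabs (clamp a b t - clamp a b x) <= Rabs (t - x).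
Proof.
intros. unfold clamp, Rmax, Rmin.
destruct (Rle_dec b t); destruct (Rle_dec b x);
 repeat destruct Rle_dec; unfold Rabs; repeat destruct Rcase_abs; lra.
Qed.

(** Composition with [clamp] extends a function from a segment to the whole line by its end values.
    Relative continuity becomes continuity everywhere, the form in which the classical theorems on
    continuous functions apply. *)
Lemma continuous_clamp (J : R -> Prop) (F : R -> R) a b :
  a <= b -> (forall t, a <= t <= b -> J t) -> continuous_on J F ->
  forall t, continuous (fun t => F (clamp a b t)) t.
Proof.
intros ab K C t. apply continuous_of_cont_at.
apply (cont_at_comp _ J).
- intros u _. apply K, clamp_range, ab.
- apply (C (clamp a b t)). apply K, clamp_range, ab.
- apply cont_at_iff. intros e ep. exists e. split; auto. intros u _ Hu.
  eapply Rle_lt_trans. apply clamp_contract; auto. auto.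
Qed.

Lemma interval_between J a b t :
  real_interval J -> J a -> J b -> Rmin a b <= t <= Rmax a b -> J t.
Proof.
intros [K _] Ja Jb. unfold Rmin, Rmax. destruct (Rle_dec a b); intros.
apply (K a b); auto. apply (K b a); auto.
Qed.

Lemma IVT_on (J : R -> Prop) (F : R -> R) a b z :
  (forall t, Rmin a b <= t <= Rmax a b -> J t) -> continuous_on J F ->
  Rmin (F a) (F b) <= z <= Rmax (F a) (F b) ->
  exists t, Rmin a b <= t <= Rmax a b /\ F t = z.
Proof.
intros K C H.
assert (ab : Rmin a b <= Rmax a b)
  by (unfold Rmin, Rmax; destruct (Rle_dec a b); lra).
assert (Ea : clamp (Rmin a b) (Rmax a b) a = a)
  by (apply clamp_id; split; [apply Rmin_l | apply Rmax_l]).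
assert (Eb : clamp (Rmin a b) (Rmax a b) b = b)
  by (apply clamp_id; split; [apply Rmin_r | apply Rmax_r]).
destruct (IVT_gen (fun t => F (clamp (Rmin a b) (Rmax a b) t)) a b z) as [t [Ht E]].
- intros t. apply continuity_pt_filterlim. apply (continuous_clamp J); auto.
- rewrite Ea, Eb. exact H.
- rewrite clamp_id in E by auto. eauto.
Qed.

Lemma antiderivative_cont J F dF : antiderivative_on J F dF -> continuous_on J F.
Proof. intros D t Jt. apply (is_derive_on_cont J F t (dF t)); auto. Qed.

Lemma MVT_on J F dF a b :
  a <= b -> (forall t, a <= t <= b -> J t) -> antiderivative_on J F dF ->
  exists c, a <= c <= b /\ F b - F a = dF c * (b - a).
Proof.
intros ab K D.
destruct (MVT_gen (fun t => F (clamp a b t)) a b dF) as [c [Hc E]].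
- rewrite Rmin_left, Rmax_right by auto. intros x Hx.
  (* At an interior point the ball of this radius stays in the segment, so the relative derivative
     is the two-sided one. *)
  apply (is_derive_on_is_derive (fun t => a <= t <= b) _ x _ (Rmin (x - a) (b - x))).
  + apply Rmin_pos; lra.
  + intros t Ht. assert (M1 := Rmin_l (x - a) (b - x)).
    assert (M2 := Rmin_r (x - a) (b - x)). apply Rabs_def2 in Ht. lra.
  + apply is_derive_on_ext with F. lra. intros; rewrite clamp_id; auto.
    apply (is_derive_on_subset _ J). exact K. lra. apply D, K. lra.
- intros. apply continuity_pt_filterlim. apply (continuous_clamp J); auto.
  eapply antiderivative_cont; eauto.
- rewrite Rmin_left, Rmax_right in Hc by auto.
  rewrite !clamp_id in E by lra. eauto.
Qed.

Lemma antiderivative_zero_const J F a b :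
  real_interval J -> antiderivative_on J F (fun _ => 0) -> J a -> J b -> F a = F b.
Proof.
intros HJ D.
assert (L : forall u v, u <= v -> J u -> J v -> F u = F v).
{ intros u v uv Ju Jv. destruct (MVT_on J F (fun _ => 0) u v) as [c [_ E]]; auto; [|lra].
  intros t Ht. apply (proj1 HJ u v); auto. }
intros Ja Jb. destruct (Rle_dec a b). auto. symmetry. apply L; auto. lra.
Qed.

Lemma nonzero_same_sign (J : R -> Prop) (F : R -> R) a b :
  real_interval J -> continuous_on J F -> (forall t, J t -> F t <> 0) ->
  J a -> J b -> 0 < F a -> 0 < F b.
Proof.
intros HJ C N Ja Jb Fa. apply Rnot_le_lt. intros Fb.
destruct (IVT_on J F a b 0) as [t [Ht E]]; auto.
- intros t Ht. apply (interval_between J a b); auto.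
- rewrite Rmin_right, Rmax_left by lra. lra.
- apply (N t); auto. apply (interval_between J a b); auto.
Qed.

(** Monotonicity traps [w]. If [w x + e] lies in [X], then [F (w t) < F (w x + e)] for [t] near [x],
    hence [w t < w x + e]; if it does not, convexity keeps all of [X] below it. The lower bound is
    symmetric. *)
Lemma cont_at_implicit (J X : R -> Prop) (F w q : R -> R) x :
  (forall a b t, X a -> X b -> a <= t <= b -> X t) ->
  (forall a b, X a -> X b -> a < b -> F a < F b) ->
  (forall t, J t -> X (w t)) -> (forall t, J t -> F (w t) = q t) ->
  J x -> cont_at J q x -> cont_at J w x.
Proof.
intros HX inc JX E Jx C. apply cont_at_iff. intros e ep.
assert (inc' : forall a b, X a -> X b -> F a < F b -> a < b).
{ intros a b Xa Xb H. apply Rnot_le_lt. intros [L|L].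
  specialize (inc _ _ Xb Xa L). lra. subst; lra. }
assert (U : exists d, 0 < d /\ forall t, J t -> Rabs (t - x) < d -> w t < w x + e).
{ destruct (classic (X (w x + e))) as [Y|Y].
  - assert (L := inc (w x) (w x + e) (JX _ Jx) Y ltac:(lra)).
    destruct (proj1 (cont_at_iff _ _ _) C (F (w x + e) - F (w x)) ltac:(lra))
      as [d [dp Hd]]. exists d. split; auto. intros t Jt Ht.
    apply inc'; auto. specialize (Hd t Jt Ht). apply Rabs_def2 in Hd.
    rewrite <- !E in Hd by auto. lra.
  - exists 1. split. lra. intros t Jt _. apply Rnot_le_lt. intros L. apply Y.
    apply (HX (w x) (w t)); auto. lra. }
assert (V : exists d, 0 < d /\ forall t, J t -> Rabs (t - x) < d -> w x - e < w t).
{ destruct (classic (X (w x - e))) as [Y|Y].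
  - assert (L := inc (w x - e) (w x) Y (JX _ Jx) ltac:(lra)).
    destruct (proj1 (cont_at_iff _ _ _) C (F (w x) - F (w x - e)) ltac:(lra))
      as [d [dp Hd]]. exists d. split; auto. intros t Jt Ht.
    apply inc'; auto. specialize (Hd t Jt Ht). apply Rabs_def2 in Hd.
    rewrite <- !E in Hd by auto. lra.
  - exists 1. split. lra. intros t Jt _. apply Rnot_le_lt. intros L. apply Y.
    apply (HX (w t) (w x)); auto. lra. }
destruct U as [d1 [dp1 H1]], V as [d2 [dp2 H2]].
exists (Rmin d1 d2). split. apply Rmin_pos; auto.
intros t Jt Ht. assert (M1 := Rmin_l d1 d2). assert (M2 := Rmin_r d1 d2).
specialize (H1 t Jt ltac:(lra)). specialize (H2 t Jt ltac:(lra)).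
apply Rabs_def1; lra.
Qed.

(** * Inverse functions *)

Definition image (J : R -> Prop) (F : R -> R) : R -> Prop :=
  fun x => exists t, J t /\ F t = x.

Definition strictly_monotone_on (J : R -> Prop) (F : R -> R) : Prop :=
  (forall a b, J a -> J b -> a < b -> F a < F b) \/
  (forall a b, J a -> J b -> a < b -> F b < F a).

Lemma derivative_nonzero_monotone J F dF :
  real_interval J -> antiderivative_on J F dF -> continuous_on J dF ->
  (forall t, J t -> dF t <> 0) -> strictly_monotone_on J F.
Proof.
intros HJ D C N. destruct (proj2 HJ) as [a [b [Ja [Jb _]]]].
destruct (Rlt_dec 0 (dF a)) as [P|P]; [left|right]; intros u v Ju Jv uv.
- destruct (MVT_on J F dF u v) as [c [Hc E]]; auto. lra.
  intros t Ht; apply (proj1 HJ u v); auto.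
  assert (0 < dF c). { apply (nonzero_same_sign J dF a c); auto. apply (proj1 HJ u v); auto. }
  nra.
- destruct (MVT_on J F dF u v) as [c [Hc E]]; auto. lra.
  intros t Ht; apply (proj1 HJ u v); auto.
  assert (0 < - 1 * dF c).
  { apply (nonzero_same_sign J (fun t => -1 * dF t) a c); auto.
    - intros t Jt. apply cont_at_mult. apply cont_at_const. apply C; auto.
    - intros t Jt. specialize (N t Jt). lra.
    - apply (proj1 HJ u v); auto.
    - specialize (N a Ja). lra. }
  nra.
Qed.

Lemma inverse_function J F dF :
  real_interval J -> antiderivative_on J F dF -> continuous_on J dF ->
  (forall t, J t -> dF t <> 0) ->
  exists G,
    real_interval (image J F) /\
    (forall t, J t -> G (F t) = t) /\
    continuous_on (image J F) G /\
    antiderivative_on (image J F) G (fun x => / dF (G x)).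
Proof.
intros HJ D C N.
assert (mono := derivative_nonzero_monotone J F dF HJ D C N).
assert (CF := antiderivative_cont J F dF D).
assert (inj : forall a b, J a -> J b -> F a = F b -> a = b).
{ intros a b Ja Jb E. destruct (Rtotal_order a b) as [L|[L|L]]; auto;
  destruct mono as [K|K]; apply K in L; auto; lra. }
assert (EG : exists G : R -> R, forall x, image J F x -> J (G x) /\ F (G x) = x).
(* A choice of preimage; outside the image the value is arbitrary. *)
{ exists (fun x => epsilon (inhabits 0) (fun t => J t /\ F t = x)).
  intros x Hx. exact (epsilon_spec (inhabits 0) (fun t => J t /\ F t = x) Hx). }
destruct EG as [G GX]. exists G.
assert (GF : forall t, J t -> G (F t) = t).
{ intros t Jt. destruct (GX (F t)) as [A B]. exists t; auto. apply inj; auto. }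
assert (CG : continuous_on (image J F) G).
{ intros x Hx. destruct mono as [K|K].
  - apply (cont_at_implicit (image J F) J F G (fun t => t)); auto.
    apply HJ. intros; apply GX; auto. intros; apply GX; auto. apply cont_at_id.
  (* A decreasing [F] is handled by changing the sign on both sides of [F (G t) = t]. *)
  - apply (cont_at_implicit (image J F) J (fun t => - F t) G (fun t => -1 * t)); auto.
    apply HJ.
    intros a b Ja Jb ab. specialize (K a b Ja Jb ab). lra.
    intros; apply GX; auto.
    intros t Ht. rewrite (proj2 (GX t Ht)). ring.
    apply cont_at_mult. apply cont_at_const. apply cont_at_id. }
split; [split | split; [exact GF | split; [exact CG |]]].
- intros x1 x2 x [a [Ja <-]] [b [Jb <-]] Hx.
  destruct (IVT_on J F a b x) as [t [Ht E]]; auto.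
  + intros t Ht. apply (interval_between J a b); auto.
  + rewrite Rmin_left, Rmax_right by lra. exact Hx.
  + exists t. split; auto. apply (interval_between J a b); auto.
- destruct HJ as [_ [a [b [Ja [Jb ab]]]]]. destruct mono as [K|K];
  specialize (K a b Ja Jb ab).
  + exists (F a), (F b). repeat split; auto. exists a; auto. exists b; auto.
  + exists (F b), (F a). repeat split; auto. exists b; auto. exists a; auto.
- intros x Hx. replace (/ dF (G x)) with (1 / dF (G x)) by (unfold Rdiv; ring).
  apply (is_derive_on_implicit (image J F) J F G (fun t => t)); auto.
  + intros; apply GX; auto.
  + apply CG; auto.
  + apply D, GX; auto.
  + apply N, GX; auto.
  + intros; apply GX; auto.
  + apply is_derive_on_id; auto.
Qed.

(** Gronwall's argument: [u^2 exp (c s)] has derivative [(2 a + c) u^2 exp (c s)]. With [m] a bound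
    of the absolute value of [a] between [t0] and [t], it is nonincreasing for [c = - 2 m], used to
    the right of [t0], and nondecreasing for [c = 2 m], used to the left. In both cases
    [u t ^ 2 <= 0]. *)
Lemma linear_ode_unique (J : R -> Prop) (a u : R -> R) t0 :
  real_interval J -> continuous_on J a ->
  antiderivative_on J u (fun t => a t * u t) -> J t0 -> u t0 = 0 ->
  forall t, J t -> u t = 0.
Proof.
intros HJ C D J0 u0 t Jt.
set (lo := Rmin t0 t). set (hi := Rmax t0 t).
assert (B : forall s, lo <= s <= hi -> J s)
  by (intros s Hs; apply (interval_between J t0 t); auto).
assert (lh : lo <= hi) by (unfold lo, hi, Rmin, Rmax; destruct Rle_dec; lra).
assert (Bt : lo <= t <= hi) by (split; [apply Rmin_r | apply Rmax_r]).
assert (Bt0 : lo <= t0 <= hi) by (split; [apply Rmin_l | apply Rmax_l]).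
destruct (continuity_ab_maj (fun s => Rabs (a (clamp lo hi s))) lo hi lh) as [s0 [M _]].
{ intros c _. apply continuity_pt_filterlim.
  apply (continuous_comp (fun s => a (clamp lo hi s)) Rabs).
  apply (continuous_clamp J); auto. apply continuous_Rabs. }
set (m := Rabs (a (clamp lo hi s0))) in M.
assert (M' : forall s, lo <= s <= hi -> - m <= a s <= m).
{ intros s Hs. specialize (M s Hs). cbv beta in M. rewrite clamp_id in M by auto.
  split; unfold Rabs in M; destruct Rcase_abs in M; lra. }
assert (DE : forall c, antiderivative_on J (fun s => u s * u s * exp (c * s))
   (fun s => (2 * a s + c) * (u s * u s * exp (c * s)))).
{ intros c s Js.
  replace ((2 * a s + c) * (u s * u s * exp (c * s))) with
   ((a s * u s * u s + u s * (a s * u s)) * exp (c * s) +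
    (u s * u s) * (exp (c * s) * (c * 1))) by ring.
  apply (is_derive_on_mult J (fun s => u s * u s) (fun s => exp (c * s))); auto.
  - apply is_derive_on_mult; auto; apply D; auto.
  - apply (is_derive_on_comp J (fun _ => True) exp (fun s => c * s) s (c * 1) (exp (c * s))); auto.
    apply is_derive_is_derive_on; auto. apply (is_derive_exp (c * s)).
    apply is_derive_on_scal; auto. apply is_derive_on_id; auto. }
assert (Z : u t * u t <= 0).
{ destruct (Rle_dec t0 t) as [L|L].
  - destruct (MVT_on J _ _ t0 t L (fun s Hs => B s ltac:(lra)) (DE (- 2 * m)))
      as [c [Hc E]].
    rewrite u0 in E.
    assert (Mc := M' c ltac:(lra)).
    assert (P := exp_pos (-2 * m * t)). assert (Q := exp_pos (-2 * m * c)).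
    assert (0 <= u c * u c * exp (-2 * m * c)) by nra.
    assert ((2 * a c + -2 * m) * (u c * u c * exp (-2 * m * c)) <= 0) by nra.
    assert ((2 * a c + -2 * m) * (u c * u c * exp (-2 * m * c)) * (t - t0) <= 0) by nra.
    nra.
  - destruct (MVT_on J _ _ t t0 ltac:(lra) (fun s Hs => B s ltac:(lra)) (DE (2 * m)))
      as [c [Hc E]].
    rewrite u0 in E.
    assert (Mc := M' c ltac:(lra)).
    assert (P := exp_pos (2 * m * t)). assert (Q := exp_pos (2 * m * c)).
    assert (0 <= u c * u c * exp (2 * m * c)) by nra.
    assert (0 <= (2 * a c + 2 * m) * (u c * u c * exp (2 * m * c))) by nra.
    assert (0 <= (2 * a c + 2 * m) * (u c * u c * exp (2 * m * c)) * (t0 - t)) by nra.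
    nra. }
nra.
Qed.

(** The clamped integrand is continuous on the whole line, so its integral from [a] is
    differentiable everywhere, with the right derivative on the segment. *)
Lemma antiderivative_exists (J : R -> Prop) a b (v : R -> R) :
  a <= b -> (forall t, a <= t <= b -> J t) -> continuous_on J v ->
  exists P, antiderivative_on (fun t => a <= t <= b) P v.
Proof.
intros ab B C.
set (w := fun t => v (clamp a b t)).
assert (Cw : forall t, continuous w t) by (apply (continuous_clamp J); auto).
exists (RInt w a). intros t Ht.
replace (v t) with (w t) by (unfold w; rewrite clamp_id; auto).
apply is_derive_is_derive_on; auto. apply (is_derive_RInt w _ a).
- apply filter_forall. intros x. apply (RInt_correct (V := R_CompleteNormedModule)).
  apply (ex_RInt_continuous (V := R_CompleteNormedModule)). auto.
- auto.
Qed.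

(** * The real form of exp(G) *)

(** The logarithm of a square is differentiable on both sides of zero; this form of the inverse
    square root avoids splitting on the sign of [q]. *)
Lemma exp_quarter_ln_sqr q : q <> 0 -> exp (- (ln (q ^ 2) / 4)) = / sqrt (Rabs q).
Proof.
intros H. assert (P := Rabs_pos_lt q H).
rewrite <- (pow2_abs q). replace (Rabs q ^ 2) with (Rabs q * Rabs q) by ring.
rewrite ln_mult, exp_Ropp by auto. f_equal.
replace ((ln (Rabs q) + ln (Rabs q)) / 4) with (ln (sqrt (Rabs q))).
apply exp_ln, sqrt_lt_R0, P.
assert (Q := sqrt_lt_R0 _ P). rewrite <- (sqrt_sqrt (Rabs q)) at 2 3 by lra.
rewrite ln_mult by auto. field.
Qed.

(* The modulus of [eG], up to sign and a constant factor. *)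
Definition eG_real (S : R) (A : R -> R) (z : R) : R :=
  z * exp (A z - ln ((z ^ 2 + z + S) ^ 2) / 4).

Lemma eG_real_sqrt S A z : z ^ 2 + z + S <> 0 ->
  eG_real S A z = z / sqrt (Rabs (z ^ 2 + z + S)) * exp (A z).
Proof.
intros H. unfold eG_real, Rminus. rewrite exp_plus, exp_quarter_ln_sqr by auto.
unfold Rdiv. ring.
Qed.

(** With [Q = z^2 + z + S], the logarithmic derivative is [1/z - 1/(2Q) - (2z+1)/(2Q) = (Q - z^2 -
    z)/(z Q) = S/(z Q)]. The arctangent, rational and arctanh exponents all have the derivative
    [- 1/(2Q)] required of [A], which unifies the three cases of [eG]. *)
Lemma eG_real_derive S A z : z <> 0 -> z ^ 2 + z + S <> 0 ->
  is_derive A z (- / (2 * (z ^ 2 + z + S))) ->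
  is_derive (eG_real S A) z (S * eG_real S A z / (z * (z ^ 2 + z + S))).
Proof.
intros z0 Q0 D.
assert (P : 0 < (z ^ 2 + z + S) ^ 2) by (apply pow2_gt_0; auto).
assert (D1 : is_derive (fun z => A z - ln ((z ^ 2 + z + S) ^ 2) / 4) z
   (- / (2 * (z ^ 2 + z + S)) - (2 * z + 1) / (2 * (z ^ 2 + z + S)))).
{ apply @is_derive_minus. exact D. auto_derive. simpl in P |- *; lra.
  field. auto. }
unfold eG_real. set (L := fun z => _) in D1.
change (is_derive (fun z => z * exp (L z)) z
  (S * (z * exp (L z)) / (z * (z ^ 2 + z + S)))).
set (m := _ - _) in D1.
assert (EL : is_derive (fun z => exp (L z)) z (m * exp (L z)))
  by exact (is_derive_comp exp L z _ _ (is_derive_exp (L z)) D1).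
assert (DM := is_derive_mult (fun z => z) (fun z => exp (L z)) z _ _
  (is_derive_id z) EL Rmult_comm).
replace (S * (z * exp (L z)) / (z * (z ^ 2 + z + S))) with
  (1 * exp (L z) + z * (m * exp (L z))). exact DM.
unfold m. field. auto.
Qed.

(** Up to a constant, [1 + (1+2z)/s] and [1 - (1+2z)/s] are the linear factors of [z^2 + z + S]. A
    segment that avoids the roots of the quadratic meets the zero of neither factor. *)
Lemma quadratic_factor_sign (s S a b : R) (e : R) :
  0 < s -> s ^ 2 = 1 - 4 * S -> e = 1 \/ e = -1 ->
  (forall t, Rmin a b <= t <= Rmax a b -> t ^ 2 + t + S <> 0) ->
  1 + e * ((1 + 2 * a) / s) < 0 <-> 1 + e * ((1 + 2 * b) / s) < 0.
Proof.
intros sp s2 e1 N.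
assert (X : forall t, 1 + e * ((1 + 2 * t) / s) < 0 <-> s + e * (1 + 2 * t) < 0).
{ intros t. replace (1 + e * ((1 + 2 * t) / s)) with ((s + e * (1 + 2 * t)) / s)
    by (field; lra). split; intros H.
  - replace (s + e * (1 + 2 * t)) with ((s + e * (1 + 2 * t)) / s * s) by (field; lra).
    nra.
  - assert (0 < / s) by (apply Rinv_0_lt_compat; auto). unfold Rdiv. nra. }
rewrite !X.
assert (Z : forall t, s + e * (1 + 2 * t) = 0 -> t ^ 2 + t + S = 0).
{ intros t Ht. destruct e1; subst e; nra. }
(* The root of [s + e (1 + 2 t)], because [e] is its own inverse. *)
assert (N' : ~ Rmin a b <= (- e * s - 1) / 2 <= Rmax a b).
{ intros H. apply (N _ H), Z. destruct e1; subst e; field. }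
unfold Rmin, Rmax in N'. destruct (Rle_dec a b); destruct e1; subst e; lra.
Qed.

(** * Modulus and phase of the complex branches *)

Lemma Csqrt_of_R_polar q :
  Csqrt_of_R q = (RtoC (sqrt (Rabs q)) * (if Rlt_dec q 0 then Ci else RtoC 1))%C.
Proof.
unfold Csqrt_of_R. destruct (Rlt_dec q 0).
- rewrite Rabs_left by auto. apply injective_projections; simpl; ring.
- rewrite Rabs_right by lra. apply injective_projections; simpl; ring.
Qed.

Lemma Cexponential_polar a x y :
  Cexponential (RtoC a * (x, y)) =
  (RtoC (exp (a * x)) * (cos (a * y), sin (a * y)))%C.
Proof.
unfold Cexponential. simpl. rewrite !Rmult_0_l, Rplus_0_r, Rminus_0_r.
apply injective_projections; simpl; ring.
Qed.

(** The imaginary part of the principal arctanh: half the difference of the arguments of [1 + r] and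
    [1 - r], each 0 or [PI]. It depends only on the signs of these two numbers. *)
Definition half_arg (r : R) : R :=
  ((if Rlt_dec (1 + r) 0 then PI else 0) - (if Rlt_dec (1 - r) 0 then PI else 0)) / 2.

Lemma Carctanh_of_R_parts r : 1 + r <> 0 -> 1 - r <> 0 ->
  Carctanh_of_R r = ((ln ((1 + r) ^ 2) - ln ((1 - r) ^ 2)) / 4, half_arg r).
Proof.
intros H1 H2. unfold Carctanh_of_R, Cln_of_R, half_arg.
assert (L : forall x, x <> 0 -> ln (x ^ 2) = 2 * ln (Rabs x)).
{ intros x Hx. rewrite <- pow2_abs. simpl. assert (P := Rabs_pos_lt x Hx).
  rewrite Rmult_1_r, ln_mult by auto. ring. }
rewrite !L by auto. apply injective_projections; simpl; field.
Qed.

Lemma Cunit_neq_0 y : (cos y, sin y) <> RtoC 0.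
Proof.
intros E. injection E as E1 E2. assert (P := sin2_cos2 y). unfold Rsqr in P.
rewrite E1, E2 in P. lra.
Qed.

Lemma log_ratio_derive (s S z : R) :
  0 < s -> s ^ 2 = 1 - 4 * S ->
  1 + (1 + 2 * z) / s <> 0 -> 1 - (1 + 2 * z) / s <> 0 ->
  is_derive (fun z => 1 / s *
    ((ln ((1 + (1 + 2 * z) / s) ^ 2) - ln ((1 - (1 + 2 * z) / s) ^ 2)) / 4)) z
    (- / (2 * (z ^ 2 + z + S))).
Proof.
intros sp s2 F1 F2.
assert (P1 := pow2_gt_0 _ F1). assert (P2 := pow2_gt_0 _ F2).
replace (z ^ 2 + z + S) with
  (- ((1 + (1 + 2 * z) / s) * (1 - (1 + 2 * z) / s) * s ^ 2) / 4)
  by (replace S with ((1 - s ^ 2) / 4) by lra; field; lra).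
auto_derive.
- simpl in P1, P2. unfold Rminus, Rdiv in *. split; [lra|split; [lra|auto]].
- assert (N1 : s + (1 + 2 * z) <> 0).
  { intros Z. apply F1. replace (1 + (1 + 2 * z) / s) with ((s + (1 + 2 * z)) / s)
      by (field; lra). rewrite Z. unfold Rdiv; ring. }
  assert (N2 : s - (1 + 2 * z) <> 0).
  { intros Z. apply F2. replace (1 - (1 + 2 * z) / s) with ((s - (1 + 2 * z)) / s)
      by (field; lra). rewrite Z. unfold Rdiv; ring. }
  unfold Rdiv, Rminus in *.
  (* The two factors add up to 2, so one of them can be eliminated. *)
  set (p := 1 + (1 + 2 * z) * / s) in *. set (m := 1 + - ((1 + 2 * z) * / s)) in *.
  assert (m = 2 - p) by (unfold p, m; ring). clearbody p m. subst m.
  field. lra.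
Qed.

Lemma Cinv_neq_0 (z : C) : z <> RtoC 0 -> (/ z)%C <> RtoC 0.
Proof.
intros H E. apply C1_nz. rewrite <- (Cinv_r z H), E. ring.
Qed.

(* [c] depends on the component of [a], through the signs of [1 + 2 z] and of
   [1 +- (1 + 2 z) / sqrt (1 - 4 S)]. *)
Lemma eG_real_form (S : R) :
  exists E : R -> R,
    (forall z, z <> 0 -> z ^ 2 + z + S <> 0 ->
       E z <> 0 /\ is_derive E z (S * E z / (z * (z ^ 2 + z + S)))) /\
    forall a, a ^ 2 + a + S <> 0 ->
      exists c : C, c <> RtoC 0 /\
      forall z, (forall t, Rmin a z <= t <= Rmax a z -> t ^ 2 + t + S <> 0) ->
        eG z S = (c * RtoC (E z))%C.
Proof.
assert (NZ : forall A z, z <> 0 -> eG_real S A z <> 0).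
{ intros A z Hz. unfold eG_real. apply Rmult_integral_contrapositive_currified; auto.
  apply Rgt_not_eq, exp_pos. }
unfold eG. destruct (total_order_T S (1 / 4)) as [[L|E]|G].
- assert (sp : 0 < sqrt (1 - 4 * S)) by (apply sqrt_lt_R0; lra).
  assert (s2 : sqrt (1 - 4 * S) ^ 2 = 1 - 4 * S) by (apply pow2_sqrt; lra).
  set (s := sqrt (1 - 4 * S)) in *.
  assert (FF : forall z, (1 + (1 + 2 * z) / s) * (1 - (1 + 2 * z) / s) * s ^ 2 =
      - 4 * (z ^ 2 + z + S)).
  { intros z. replace S with ((1 - s ^ 2) / 4) by lra. field. lra. }
  assert (F : forall z, z ^ 2 + z + S <> 0 ->
     1 + (1 + 2 * z) / s <> 0 /\ 1 - (1 + 2 * z) / s <> 0).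
  { intros z Hz. specialize (FF z). split; intros Z; rewrite Z in FF; lra. }
  pose (A := fun z => 1 / s *
    ((ln ((1 + (1 + 2 * z) / s) ^ 2) - ln ((1 - (1 + 2 * z) / s) ^ 2)) / 4)).
  exists (eG_real S A). split.
  + intros z Hz Qz. split. auto. apply eG_real_derive; auto.
    destruct (F z Qz) as [F1 F2]. apply log_ratio_derive; auto.
  + intros a Qa. destruct (F a Qa) as [Fa1 Fa2].
    (* [u] is the phase of the complex square root and [d] that of the exponential; their quotient
       is the constant [c]. Both are determined by the signs of the linear factors, which do not
       change between [a] and [z]. *)
    pose (u := fun z => if Rlt_dec (z ^ 2 + z + S) 0 then Ci else RtoC 1).
    pose (d := fun z => (cos (1 / s * half_arg ((1 + 2 * z) / s)),
                         sin (1 / s * half_arg ((1 + 2 * z) / s)))).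
    assert (u0 : forall z, u z <> RtoC 0).
    { intros z. unfold u. destruct Rlt_dec; intros Z; injection Z; lra. }
    exists (d a / u a)%C. split.
    * apply Cmult_neq_0. apply Cunit_neq_0. apply Cinv_neq_0, u0.
    * intros z Hz.
      assert (Qz : z ^ 2 + z + S <> 0) by (apply Hz; split; [apply Rmin_r|apply Rmax_r]).
      destruct (F z Qz) as [F1 F2].
      assert (S1 := quadratic_factor_sign s S a z 1 sp s2 ltac:(auto) Hz).
      assert (S2 := quadratic_factor_sign s S a z (-1) sp s2 ltac:(auto) Hz).
      rewrite Carctanh_of_R_parts, Cexponential_polar, Csqrt_of_R_polar by auto.
      assert (Ed : d z = d a).
      { unfold d, half_arg.
        repeat destruct Rlt_dec; try reflexivity; exfalso; lra. }
      assert (Eu : u z = u a).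
      { assert (T : forall t, t ^ 2 + t + S < 0 <->
          0 < (1 + (1 + 2 * t) / s) * (1 - (1 + 2 * t) / s)).
        { intros t. specialize (FF t). assert (0 < s ^ 2) by nra. split; nra. }
        assert (T' : z ^ 2 + z + S < 0 <-> a ^ 2 + a + S < 0).
        { rewrite !T. unfold Rminus.
          split; intros P; destruct (Rlt_dec (1 + (1 + 2 * a) / s) 0);
            destruct (Rlt_dec (1 - (1 + 2 * a) / s) 0); nra. }
        unfold u. repeat destruct Rlt_dec; try reflexivity; exfalso; tauto. }
      fold (u z). fold (d z). fold (A z). rewrite Ed, Eu.
      assert (Q' : sqrt (Rabs (z ^ 2 + z + S)) <> 0)
        by (apply Rgt_not_eq, sqrt_lt_R0, Rabs_pos_lt; auto).
      rewrite eG_real_sqrt by auto. unfold Rdiv. rewrite !RtoC_mult, RtoC_inv by auto.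
      field. split; auto. intros Z. apply Q'. injection Z; auto.
- exists (eG_real S (fun z => 1 / (1 + 2 * z))). split.
  + intros z Hz Qz. split. auto. apply eG_real_derive; auto.
    assert (1 + 2 * z <> 0) by (intros Z; apply Qz; nra).
    replace (z ^ 2 + z + S) with ((1 + 2 * z) ^ 2 / 4) by (rewrite E; field).
    auto_derive. auto. field. auto.
  + intros a Qa.
    (* Here [z^2 + z + S = ((1+2z)/2)^2], so the root in [eG_real] is half the absolute value of
       [1 + 2z], whereas [eG] divides by [1 + 2z] itself. *)
    pose (c := fun z => if Rlt_dec (1 + 2 * z) 0 then - / 2 else / 2).
    exists (RtoC (c a)). split.
    { intros Z. injection Z. unfold c. destruct Rlt_dec; lra. }
    intros z Hz.
    assert (Qz : z ^ 2 + z + S <> 0) by (apply Hz; split; [apply Rmin_r|apply Rmax_r]).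
    assert (Ec : c z = c a).
    { assert (N : ~ Rmin a z <= - / 2 <= Rmax a z).
      { intros H. apply (Hz _ H). rewrite E. field. }
      unfold c, Rmin, Rmax in *. destruct (Rle_dec a z);
      repeat destruct Rlt_dec; try reflexivity; exfalso; lra. }
    rewrite <- Ec, <- RtoC_mult. f_equal. rewrite eG_real_sqrt by auto.
    assert (1 + 2 * z <> 0) by (intros Z; apply Qz; nra).
    replace (z ^ 2 + z + S) with ((1 + 2 * z) / 2 * ((1 + 2 * z) / 2)) by (rewrite E; field).
    rewrite Rabs_mult, sqrt_square by apply Rabs_pos.
    unfold c. destruct Rlt_dec.
    * rewrite Rabs_left by lra. field. auto.
    * rewrite Rabs_right by lra. field. auto.
- assert (qp : 0 < sqrt (4 * S - 1)) by (apply sqrt_lt_R0; lra).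
  assert (q2 : sqrt (4 * S - 1) ^ 2 = 4 * S - 1) by (apply pow2_sqrt; lra).
  set (q := sqrt (4 * S - 1)) in *.
  exists (eG_real S (fun z => - (1 / q * atan ((1 + 2 * z) / q)))). split.
  + intros z Hz Qz. split. auto. apply eG_real_derive; auto.
    replace (z ^ 2 + z + S) with ((q ^ 2 + (1 + 2 * z) ^ 2) / 4) by (rewrite q2; field).
    auto_derive. auto. field. split; nra.
  + intros a _. exists (RtoC 1). split. apply C1_nz. intros z _.
    assert (0 < z ^ 2 + z + S) by (assert (P := pow2_ge_0 (z + 1 / 2)); lra).
    rewrite <- RtoC_mult, Rmult_1_l, eG_real_sqrt, Rabs_right by lra. reflexivity.
Qed.

(** Excludes [theta = 0] along a branch, the right-hand side of the algebraic equation being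
    nonzero. *)
Lemma eG_0 S : eG 0 S = RtoC 0.
Proof.
unfold eG. destruct total_order_T as [[|]|]; unfold Rdiv, Cdiv.
- ring.
- f_equal. ring.
- f_equal. ring.
Qed.

(** * Reduction to a separable equation *)

Lemma near_in_subset I y0 delta : subset (near_in I y0 delta) I.
Proof. intros t [It _]. exact It. Qed.

Lemma real_interval_near_in I y0 delta :
  real_interval I -> I y0 -> 0 < delta -> real_interval (near_in I y0 delta).
Proof.
intros [K [a [b [Ia [Ib ab]]]]] I0 dp. split.
- intros u v t [Iu Hu] [Iv Hv] Ht. split. apply (K u v); auto.
  apply Rabs_def2 in Hu. apply Rabs_def2 in Hv. apply Rabs_def1; lra.
(* [y0] may be an endpoint of [I]; another point of [I] shows on which side there is room. *)
- assert (M : exists c, I c /\ c <> y0).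
  { destruct (Req_dec a y0). exists b; split; auto; lra. exists a; auto. }
  destruct M as [c [Ic Nc]].
  assert (I0' : near_in I y0 delta y0).
  { split; auto. rewrite Rminus_diag_eq, Rabs_R0; auto. }
  destruct (Rlt_dec c y0) as [L|L].
  + assert (M := Rmax_l c (y0 - delta / 2)). assert (M' := Rmax_r c (y0 - delta / 2)).
    assert (Rmax c (y0 - delta / 2) < y0) by (apply Rmax_lub_lt; lra).
    exists (Rmax c (y0 - delta / 2)), y0. repeat split; auto.
    * apply (K c y0); auto. lra.
    * apply Rabs_def1; lra.
    * apply I0'.
  + assert (M := Rmin_l c (y0 + delta / 2)). assert (M' := Rmin_r c (y0 + delta / 2)).
    assert (y0 < Rmin c (y0 + delta / 2)) by (apply Rmin_glb_lt; lra).
    exists y0, (Rmin c (y0 + delta / 2)). repeat split; auto.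
    * apply I0'.
    * apply (K y0 c); auto. lra.
    * apply Rabs_def1; lra.
Qed.

(** Every value between [w a] and [w b] is attained on [J]. This confines a continuous [theta] to
    one component of the set where [eG] is defined, or where the cubic does not vanish. *)
Lemma path_avoids (J P : R -> Prop) (w : R -> R) a b t :
  real_interval J -> continuous_on J w -> (forall y, J y -> P (w y)) ->
  J a -> J b -> Rmin (w a) (w b) <= t <= Rmax (w a) (w b) -> P t.
Proof.
intros HJ C H Ja Jb Ht.
destruct (IVT_on J w a b t) as [s [Hs <-]]; auto.
- intros s Hs. apply (interval_between J a b); auto.
- apply H. apply (interval_between J a b); auto.
Qed.

(** * The separable equation and its first integral *)

Definition cubic (S z : R) : R := z * (z ^ 2 + z + S).

Lemma continuous_cubic J w S x :
  cont_at J w x -> cont_at J (fun t => cubic S (w t)) x.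
Proof.
intros C. unfold cubic. simpl.
repeat first [apply cont_at_plus | apply cont_at_mult | apply cont_at_const
  | exact C].
Qed.

(** Here (star) survives only through its differentiated form [red_rho_derive]; the sign, the square
    root and the antiderivative of [h] no longer appear. *)
Record reducible (I : R -> Prop) (f g h k vp rho : R -> R) (S : R) : Prop := {
  red_S : S <> 0;
  red_h : forall y, I y -> h y <> 0;
  red_h_cont : continuous_on I h;
  red_vp : antiderivative_on I vp
    (fun y => k y + f y * vp y + g y * vp y ^ 2 + h y * vp y ^ 3);
  red_vp_root : forall y, I y -> 3 * h y * vp y ^ 2 + 2 * g y * vp y + f y = 0;
  red_rho : forall y, I y -> rho y = 3 * vp y + g y / h y;
  red_rho_neq : forall y, I y -> rho y <> 0;
  red_rho_derive : antiderivative_on I rho (fun y => - S * h y * rho y ^ 3) }.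

Arguments red_S {I f g h k vp rho S}.
Arguments red_h {I f g h k vp rho S}.
Arguments red_h_cont {I f g h k vp rho S}.
Arguments red_vp {I f g h k vp rho S}.
Arguments red_vp_root {I f g h k vp rho S}.
Arguments red_rho {I f g h k vp rho S}.
Arguments red_rho_neq {I f g h k vp rho S}.
Arguments red_rho_derive {I f g h k vp rho S}.

Definition theta_solution (h rho : R -> R) (S : R) (J : R -> Prop)
  (theta : R -> R) : Prop :=
  antiderivative_on J theta (fun y => h y * rho y ^ 2 * cubic S (theta y)).

Section Reduction.

Context {I : R -> Prop} {f g h k vp rho : R -> R} {S : R}.
Context (red : reducible I f g h k vp rho S).

Lemma abel_to_theta J v : abel_solution f g h k I J v ->
  theta_solution h rho S J (fun y => (v y - vp y) / rho y).
Proof.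
intros [JI D] y Jy. assert (Iy := JI y Jy).
assert (R0 := red_rho_neq red y Iy).
assert (H0 := red_h red y Iy).
assert (Dvp := is_derive_on_subset J I _ _ _ JI Jy (red_vp red y Iy)).
assert (Drho := is_derive_on_subset J I _ _ _ JI Jy (red_rho_derive red y Iy)).
assert (DD := is_derive_on_mult J _ _ y _ _ Jy
  (is_derive_on_plus J _ _ y _ _ Jy (D y Jy) (is_derive_on_scal J _ y (-1) _ Jy Dvp))
  (is_derive_on_inv J _ y _ Jy Drho R0)).
apply (is_derive_on_eq _ _ _ _ _ _ Jy DD).
{ intros t _. unfold Rdiv; ring. }
assert (E1 := red_vp_root red y Iy).
assert (E2 := red_rho red y Iy).
unfold cubic.
(* With [f] and [g] expressed by [h], [vp] and [rho], the claim becomes a rational identity. *)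
replace (f y) with (- (3 * h y * vp y ^ 2 + 2 * g y * vp y)) by lra.
assert (Eg : g y = h y * (rho y - 3 * vp y)) by (rewrite E2; field; auto).
rewrite Eg. field. auto.
Qed.

Lemma theta_to_abel J theta : subset J I -> theta_solution h rho S J theta ->
  abel_solution f g h k I J (fun y => rho y * theta y + vp y).
Proof.
intros JI D. split. exact JI. intros y Jy. assert (Iy := JI y Jy).
assert (H0 := red_h red y Iy).
assert (Dvp := is_derive_on_subset J I _ _ _ JI Jy (red_vp red y Iy)).
assert (Drho := is_derive_on_subset J I _ _ _ JI Jy (red_rho_derive red y Iy)).
assert (DD := is_derive_on_plus J _ _ y _ _ Jy
  (is_derive_on_mult J _ _ y _ _ Jy Drho (D y Jy)) Dvp).
apply (is_derive_on_eq _ _ _ _ _ _ Jy DD); auto.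
assert (E1 := red_vp_root red y Iy).
assert (E2 := red_rho red y Iy).
unfold cubic.
replace (f y) with (- (3 * h y * vp y ^ 2 + 2 * g y * vp y)) by lra.
assert (Eg : g y = h y * (rho y - 3 * vp y)) by (rewrite E2; field; auto).
rewrite Eg. ring.
Qed.

(** Since [cubic S c = 0], the difference [theta - c] divides [cubic S theta], with quotient
    [theta^2 + (c+1) theta + c^2 + c + S]. Thus [theta - c] solves a homogeneous linear equation
    with continuous coefficient and vanishes at [y0]. *)
Lemma theta_root_const J theta y0 :
  real_interval J -> subset J I -> theta_solution h rho S J theta ->
  J y0 -> cubic S (theta y0) = 0 -> forall y, J y -> theta y = theta y0.
Proof.
intros HJ JI D J0 Z. set (c := theta y0) in *.
assert (Ct := antiderivative_cont J theta _ D).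
assert (U : forall y, J y -> theta y + - c = 0).
{ apply (linear_ode_unique J (fun y => h y * (rho y * rho y) *
    (theta y * theta y + (c + 1) * theta y + (c * c + c + S))) _ y0); auto.
  - apply cont_at_continuous_on. intros y Jy.
    repeat first [apply cont_at_plus | apply cont_at_mult | apply cont_at_const].
    all: try (apply (Ct y); auto).
    all: apply (cont_at_subset J I); auto.
    apply (red_h_cont red); auto.
    all: apply (antiderivative_cont I rho _ (red_rho_derive red)); auto.
  - intros y Jy.
    assert (DD := is_derive_on_plus J _ _ y _ _ Jy (D y Jy)
      (is_derive_on_const J (- c) y Jy)).
    apply (is_derive_on_eq _ _ _ _ _ _ Jy DD); auto.
    unfold cubic in *.
    replace (theta y * (theta y ^ 2 + theta y + S)) with
     (theta y * (theta y ^ 2 + theta y + S) - c * (c ^ 2 + c + S)) by (rewrite Z; ring).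
    ring.
  - unfold c. ring. }
intros y Jy. specialize (U y Jy). lra.
Qed.

Context {E : R -> R}.
Context (DE : forall z, z <> 0 -> z ^ 2 + z + S <> 0 ->
       E z <> 0 /\ is_derive E z (S * E z / (z * (z ^ 2 + z + S)))).

Lemma cubic_neq_0 z : cubic S z <> 0 -> z <> 0 /\ z ^ 2 + z + S <> 0.
Proof.
unfold cubic. intros H. split; intros Z; apply H; rewrite Z; ring.
Qed.

(** In the derivative of [E (theta) rho], the first factor contributes [S E h rho^3], the cubic
    cancelling, and the second contributes [- S h rho^3 E]. *)
Lemma theta_first_integral J theta :
  real_interval J -> subset J I -> theta_solution h rho S J theta ->
  (forall y, J y -> cubic S (theta y) <> 0) ->
  exists kappa, kappa <> 0 /\ forall y, J y -> E (theta y) * rho y = kappa.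
Proof.
intros HJ JI D N. destruct (proj2 HJ) as [y0 [_ [J0 _]]].
exists (E (theta y0) * rho y0). split.
{ apply Rmult_integral_contrapositive_currified.
  apply DE; apply cubic_neq_0; auto. apply (red_rho_neq red); auto. }
intros y Jy. apply (antiderivative_zero_const J (fun y => E (theta y) * rho y)); auto.
clear y Jy. intros y Jy.
destruct (cubic_neq_0 _ (N y Jy)) as [N1 N2]. destruct (DE _ N1 N2) as [_ DEy].
assert (Drho := is_derive_on_subset J I _ _ _ JI Jy (red_rho_derive red y (JI y Jy))).
assert (DD := is_derive_on_mult J _ _ y _ _ Jy
  (is_derive_on_comp J (fun _ => True) E theta y _ _ Jy (fun _ _ => Logic.I)
     (is_derive_is_derive_on _ E _ _ Logic.I DEy) (D y Jy)) Drho).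
apply (is_derive_on_eq _ _ _ _ _ _ Jy DD); auto.
unfold cubic. field. auto.
Qed.

(** A merely continuous [theta] is differentiable because it solves [E (theta) = kappa / rho] and
    [E'] does not vanish, [S] being nonzero. *)
Lemma theta_from_first_integral J theta kappa :
  subset J I -> continuous_on J theta ->
  (forall y, J y -> cubic S (theta y) <> 0) ->
  (forall y, J y -> E (theta y) * rho y = kappa) -> theta_solution h rho S J theta.
Proof.
intros JI C N K y Jy. assert (Iy := JI y Jy).
destruct (cubic_neq_0 _ (N y Jy)) as [N1 N2]. destruct (DE _ N1 N2) as [E0 DEy].
assert (R0 := red_rho_neq red y Iy).
assert (S0 := red_S red).
assert (Drho := is_derive_on_subset J I _ _ _ JI Jy (red_rho_derive red y Iy)).
assert (DQ := is_derive_on_scal J _ y kappa _ Jy (is_derive_on_inv J _ y _ Jy Drho R0)).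
assert (M0 : S * E (theta y) / (theta y * (theta y ^ 2 + theta y + S)) <> 0).
{ unfold Rdiv. repeat apply Rmult_integral_contrapositive_currified; auto.
  apply Rinv_neq_0_compat. apply Rmult_integral_contrapositive_currified; auto. }
assert (KQ : forall t, J t -> E (theta t) = kappa * / rho t).
{ intros t Jt. rewrite <- (K t Jt). field.
  apply (red_rho_neq red); auto. }
assert (DD := is_derive_on_implicit J (fun _ => True) E theta _ y _ _ Jy
  (fun _ _ => Logic.I) (C y Jy) (is_derive_is_derive_on _ E _ _ Logic.I DEy) M0 KQ DQ).
apply (is_derive_on_eq _ _ _ _ _ _ Jy DD); auto.
rewrite <- (K y Jy). unfold cubic. field. auto.
Qed.

(** Near [z0] the function [E] has a nonzero derivative, hence a continuous inverse, which is
    applied to [E z0 * rho y0 / rho y]. *)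
Lemma first_integral_local y0 z0 :
  I y0 -> cubic S z0 <> 0 ->
  exists delta theta, 0 < delta /\
    continuous_on (near_in I y0 delta) theta /\
    (forall y, near_in I y0 delta y ->
       cubic S (theta y) <> 0 /\ E (theta y) * rho y = E z0 * rho y0) /\
    theta y0 = z0.
Proof.
intros I0 N0.
assert (Cc : forall z, cont_at (fun _ => True) (cubic S) z).
{ intros z. apply (continuous_cubic _ (fun t => t)). apply cont_at_id. }
destruct (proj1 (cont_at_iff _ _ _) (Cc z0) (Rabs (cubic S z0))) as [d [dp Hd]].
{ apply Rabs_pos_lt; auto. }
pose (X := fun z => Rabs (z - z0) < d).
assert (HX : real_interval X).
{ split.
  - intros a b t Ha Hb Ht. apply Rabs_def2 in Ha. apply Rabs_def2 in Hb.
    apply Rabs_def1; lra.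
  - exists z0, (z0 + d / 2). repeat split; try lra; apply Rabs_def1; lra. }
assert (NX : forall z, X z -> cubic S z <> 0).
{ intros z Xz Z. specialize (Hd z Logic.I Xz). rewrite Z in Hd.
  rewrite Rminus_0_l, Rabs_Ropp in Hd. lra. }
assert (DX : antiderivative_on X E (fun z => S * E z / cubic S z)).
{ intros z Xz. destruct (cubic_neq_0 _ (NX z Xz)) as [N1 N2].
  apply is_derive_is_derive_on; auto. apply DE; auto. }
assert (CX := antiderivative_cont _ _ _ DX).
assert (CdX : continuous_on X (fun z => S * E z / cubic S z)).
{ intros z Xz. apply (cont_at_mult X (fun z => S * E z)).
  apply cont_at_mult. apply cont_at_const. apply (CX z Xz).
  apply cont_at_inv; auto. apply (cont_at_subset X (fun _ => True)); auto. easy. }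
assert (NdX : forall z, X z -> S * E z / cubic S z <> 0).
{ intros z Xz. destruct (cubic_neq_0 _ (NX z Xz)) as [N1 N2].
  unfold Rdiv. repeat apply Rmult_integral_contrapositive_currified.
  apply (red_S red). apply DE; auto. apply Rinv_neq_0_compat; auto. }
destruct (inverse_function X E _ HX DX CdX NdX) as [G [HG [GE [CG _]]]].
assert (mono := derivative_nonzero_monotone X E _ HX DX CdX NdX).
set (q := fun y => E z0 * rho y0 * / rho y).
assert (R0 := red_rho_neq red).
assert (Cq : continuous_on I q).
{ intros y Iy. apply cont_at_mult. apply cont_at_const. apply cont_at_inv; auto.
  apply (antiderivative_cont I rho _ (red_rho_derive red)); auto. }
assert (q0 : q y0 = E z0) by (unfold q; field; auto).
assert (Xl : X (z0 - d / 2)) by (apply Rabs_def1; lra).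
assert (Xr : X (z0 + d / 2)) by (apply Rabs_def1; lra).
assert (X0 : X z0) by (apply Rabs_def1; lra).
(* The image of [X] is an interval and contains [E (z0 - d/2)] and [E (z0 + d/2)], which lie
   strictly on opposite sides of [E z0]. *)
assert (V : exists e, 0 < e /\ forall w, Rabs (w - E z0) < e -> image X E w).
{ assert (Il : image X E (E (z0 - d / 2))) by (eexists; eauto).
  assert (Ir : image X E (E (z0 + d / 2))) by (eexists; eauto).
  destruct mono as [M|M];
  assert (Ml := M (z0 - d / 2) z0 Xl X0 ltac:(lra));
  assert (Mr := M z0 (z0 + d / 2) X0 Xr ltac:(lra)).
  - exists (Rmin (E z0 - E (z0 - d / 2)) (E (z0 + d / 2) - E z0)).
    split. apply Rmin_pos; lra. intros w Hw. apply (proj1 HG _ _ w Il Ir).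
    assert (A1 := Rmin_l (E z0 - E (z0 - d / 2)) (E (z0 + d / 2) - E z0)).
    assert (A2 := Rmin_r (E z0 - E (z0 - d / 2)) (E (z0 + d / 2) - E z0)).
    apply Rabs_def2 in Hw. lra.
  - exists (Rmin (E (z0 - d / 2) - E z0) (E z0 - E (z0 + d / 2))).
    split. apply Rmin_pos; lra. intros w Hw. apply (proj1 HG _ _ w Ir Il).
    assert (A1 := Rmin_l (E (z0 - d / 2) - E z0) (E z0 - E (z0 + d / 2))).
    assert (A2 := Rmin_r (E (z0 - d / 2) - E z0) (E z0 - E (z0 + d / 2))).
    apply Rabs_def2 in Hw. lra. }
destruct V as [e [ep He]].
destruct (proj1 (cont_at_iff _ _ _) (Cq y0 I0) e ep) as [delta [deltap Hdelta]].
assert (Im : forall y, near_in I y0 delta y -> image X E (q y)).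
{ intros y [Iy Hy]. apply He. rewrite <- q0. auto. }
assert (GX : forall w, image X E w -> X (G w) /\ E (G w) = w).
{ intros w [z [Xz <-]]. rewrite GE; auto. }
exists delta, (fun y => G (q y)). repeat split; auto.
- intros y Hy. apply (cont_at_comp _ (image X E)); auto. apply (CG (q y)); auto.
  apply (cont_at_subset _ I). apply near_in_subset. apply (Cq y). apply Hy.
- apply NX, GX, Im; auto.
- rewrite (proj2 (GX _ (Im y H))). unfold q. field. apply R0, H.
- rewrite q0. auto.
Qed.

End Reduction.

(** * Quadratures *)

Lemma abel_integrable base I f g h k vp rho S :
  reducible I f g h k vp rho S -> In g base -> In h base ->
  (forall J, subset J I -> quadrature base I J rho) ->
  exactly_integrable base I (abel_solution f g h k I).
Proof.
intros red Ig Ih Qrho J v HJ HV.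
assert (D := abel_to_theta red J v HV). destruct HV as [JI _].
set (theta := fun y => (v y - vp y) / rho y) in D.
assert (R0 := red_rho_neq red).
assert (H0 := red_h red).
assert (Ev : forall y, J y -> v y = rho y * theta y + vp y)
  by (intros y Jy; unfold theta; field; auto).
clearbody theta.
assert (Qh : quadrature base I J h) by (apply quad_base; auto).
assert (Qg : quadrature base I J g) by (apply quad_base; auto).
specialize (Qrho J JI).
assert (QV : quadrature base I J theta -> quadrature base I J v).
(* [vp] is not assumed to be a quadrature; it is recovered as [(rho - g/h) / 3]. *)
{ intros Qt. apply quad_ext with
    (a := fun y => rho y * theta y + / 3 * (rho y + -1 * (g y * / h y))).
  - intros y Jy. rewrite Ev by auto.
    rewrite (red_rho red y (JI y Jy)) at 2. field. auto.
  - repeat first [apply quad_plus | apply quad_const | apply quad_mult]; auto.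
    apply quad_inv; auto. }
apply QV. clear QV.
destruct (classic (exists y0, J y0 /\ cubic S (theta y0) = 0)) as [[y0 [J0 Z]]|N].
{ apply quad_ext with (a := fun _ => theta y0).
  - intros y Jy. symmetry. apply (theta_root_const red J); auto.
  - apply quad_const. }
assert (N' : forall y, J y -> cubic S (theta y) <> 0) by (intros y Jy Z; eauto).
destruct (eG_real_form S) as [E [DE _]].
destruct (proj2 HJ) as [y0 [_ [J0 _]]].
assert (Ct := antiderivative_cont J theta _ D).
set (c := theta y0).
(* The component of [c] in the set where the cubic does not vanish. *)
pose (X := fun z => forall t, Rmin c z <= t <= Rmax c z -> cubic S t <> 0).
assert (XN : forall z, X z -> cubic S z <> 0).
{ intros z Xz. apply Xz. split; [apply Rmin_r | apply Rmax_r]. }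
(* Squaring makes the logarithm meaningful for either sign of [E]. *)
assert (DF : antiderivative_on X (fun z => ln (E z * E z)) (fun z => 2 * S * / cubic S z)).
{ intros z Xz. apply is_derive_is_derive_on; auto.
  destruct (cubic_neq_0 _ (XN z Xz)) as [N1 N2]. destruct (DE z N1 N2) as [E0 DEz].
  assert (P : 0 < E z * E z) by nra.
  assert (DM := is_derive_mult E E z _ _ DEz DEz Rmult_comm).
  assert (DL := is_derive_comp ln (fun z => E z * E z) z _ _ (is_derive_ln _ P) DM).
  replace (2 * S * / cubic S z) with
   ((S * E z / (z * (z ^ 2 + z + S)) * E z + E z * (S * E z / (z * (z ^ 2 + z + S))))
     * / (E z * E z)). exact DL.
  unfold cubic. field. auto. }
apply (quad_implicit base I J X (fun z => ln (E z * E z)) (fun z => 2 * S * / cubic S z)).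
- split.
  + intros a b t Xa Xb Ht u Hu.
    destruct (Rle_dec (Rmin c a) u) as [L|L]; [destruct (Rle_dec u (Rmax c a)) as [L'|L']|].
    * apply Xa; auto.
    * apply Xb. unfold Rmin, Rmax in *.
      destruct (Rle_dec c a); destruct (Rle_dec c b); destruct (Rle_dec c t); lra.
    * apply Xb. unfold Rmin, Rmax in *.
      destruct (Rle_dec c a); destruct (Rle_dec c b); destruct (Rle_dec c t); lra.
  + assert (Cc : cont_at (fun _ => True) (cubic S) c).
    { apply (continuous_cubic _ (fun t => t)). apply cont_at_id. }
    destruct (proj1 (cont_at_iff _ _ _) Cc (Rabs (cubic S c))) as [d [dp Hd]].
    { apply Rabs_pos_lt, N', J0. }
    assert (B : forall t, c <= t <= c + d / 2 -> cubic S t <> 0).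
    { intros t Ht Z. specialize (Hd t Logic.I ltac:(apply Rabs_def1; lra)).
      rewrite Z, Rminus_0_l, Rabs_Ropp in Hd. lra. }
    exists c, (c + d / 2). repeat split; try lra; intros t Ht; apply B;
    rewrite Rmin_left, Rmax_right in Ht; lra.
- exact DF.
- intros z Xz. apply Rmult_integral_contrapositive_currified.
  assert (S0 := red_S red). lra. apply Rinv_neq_0_compat; auto.
(* The logarithm is obtained as an indefinite integral of a rational function, uniformly in [S]. *)
- apply quad_integral with (1 := DF). unfold cubic. simpl.
  apply quad_mult. apply quad_const. apply quad_inv. exact XN.
  repeat first [apply quad_plus | apply quad_const | apply quad_mult | apply quad_var].
- intros y Jy t Ht. apply (path_avoids J (fun z => cubic S z <> 0) theta y0 y); auto.
(* Along the solution the cubic cancels from the derivative, leaving a function of the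
   coefficients. *)
- apply quad_integral with (a := fun y => 2 * S * (h y * (rho y * rho y))).
  + intros y Jy.
    assert (Xy : forall y, J y -> X (theta y)).
    { intros u Ju t Ht. apply (path_avoids J (fun z => cubic S z <> 0) theta y0 u); auto. }
    assert (DD := is_derive_on_comp J X _ theta y _ _ Jy Xy (DF _ (Xy y Jy)) (D y Jy)).
    apply (is_derive_on_eq _ _ _ _ _ _ Jy DD); auto. field. auto.
  + repeat first [apply quad_mult | apply quad_const]; auto.
Qed.

(** * Passage between the Lienard and the Abel equation *)

Lemma lienard_to_abel f g h k I X y y1 :
  real_interval X -> lienard_solution f g h k I X y y1 ->
  (forall x, X x -> y1 x <> 0) ->
  exists xi,
    real_interval (image X y) /\
    (forall x, X x -> xi (y x) = x) /\
    antiderivative_on (image X y) xi (fun t => / y1 (xi t)) /\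
    abel_solution f g h k I (image X y) (fun t => / y1 (xi t)).
Proof.
intros HX [y2 HL] N.
assert (D1 : antiderivative_on X y y1) by (intros x Xx; apply HL; auto).
assert (D2 : antiderivative_on X y1 y2) by (intros x Xx; apply HL; auto).
destruct (inverse_function X y y1 HX D1 (antiderivative_cont _ _ _ D2) N)
  as [xi [HJ [HG [CG DG]]]].
exists xi. split; [exact HJ | split; [exact HG | split; [exact DG | split]]].
{ intros t [x [Xx <-]]. apply HL; auto. }
intros t Jt. assert (Jt' := Jt). destruct Jt' as [x [Xx Hx]].
assert (XX : forall t, image X y t -> X (xi t)).
{ intros u [x' [Xx' <-]]. rewrite HG; auto. }
assert (Ex : xi t = x) by (rewrite <- Hx; auto).
(* The chain rule gives [v' = - y'' / y'^3], so (A) is (L) divided by [y'^3]. *)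
assert (DD := is_derive_on_inv _ _ t _ Jt
  (is_derive_on_comp _ X y1 xi t _ _ Jt XX (D2 _ (XX t Jt)) (DG t Jt)) (N _ (XX t Jt))).
apply (is_derive_on_eq _ _ _ _ _ _ Jt DD); auto.
rewrite Ex. destruct (HL x Xx) as [_ [_ [_ EL]]]. rewrite Hx in EL.
specialize (N x Xx).
replace (y2 x) with (- (f t * y1 x ^ 2 + k t * y1 x ^ 3 + g t * y1 x + h t)) by lra.
field. auto.
Qed.

Lemma abel_to_lienard f g h k I J v T X y x0 :
  abel_solution f g h k I J v -> antiderivative_on J T v ->
  continuous_on X y ->
  (forall x, X x -> J (y x) /\ v (y x) <> 0 /\ T (y x) = x + - x0) ->
  lienard_solution f g h k I X y (fun x => / v (y x)).
Proof.
intros [JI D] DT C H.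
(* From [y' = 1 / v (y)] follows [y'' = - v' (y) / v (y)^3], with [v'] taken from (A). *)
exists (fun x => - (k (y x) + f (y x) * v (y x) + g (y x) * v (y x) ^ 2 +
  h (y x) * v (y x) ^ 3) * (/ v (y x)) ^ 3).
intros x Xx. destruct (H x Xx) as [Jy [Nv _]].
assert (XJ : forall x, X x -> J (y x)) by (intros; apply H; auto).
assert (ET : forall x, X x -> T (y x) = x + - x0) by (intros; apply H; auto).
assert (Dy := is_derive_on_implicit X J T y _ x _ _ Xx XJ (C x Xx) (DT _ Jy) Nv ET
  (is_derive_on_plus _ _ _ _ _ _ Xx (is_derive_on_id X x Xx) (is_derive_on_const X _ x Xx))).
assert (Dy' : is_derive_on X y x (/ v (y x))).
{ apply (is_derive_on_eq _ _ _ _ _ _ Xx Dy); auto. field. auto. }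
split; [auto|split; [exact Dy'|split]].
- assert (DD := is_derive_on_inv _ _ x _ Xx
    (is_derive_on_comp X J v y x _ _ Xx XJ (D _ Jy) Dy') Nv).
  apply (is_derive_on_eq _ _ _ _ _ _ Xx DD); auto. field. auto.
- field. auto.
Qed.

Lemma lienard_integrable base I f g h k :
  exactly_integrable base I (abel_solution f g h k I) ->
  exactly_integrable base I (lienard_regular_solution f g h k I).
Proof.
intros HA X y HX [y1 [HL N]].
destruct (lienard_to_abel f g h k I X y y1 HX HL N) as [xi [HJ [Hxi [Dxi Hv]]]].
apply (quad_implicit base I X (image X y) xi (fun t => / y1 (xi t))); auto.
- intros t [x [Xx <-]]. apply Rinv_neq_0_compat. rewrite Hxi; auto.
- apply quad_integral with (1 := Dxi). apply HA; auto.
- intros x Xx. exists x; auto.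
- apply quad_ext with (a := fun x => x). intros x Xx; symmetry; auto. apply quad_var.
Qed.

(** * The solution families *)

Lemma smooth_on_cont I a : smooth_on I a -> continuous_on I a.
Proof.
intros [d [E D]] t It. apply (cont_at_ext I (d 0%nat)); auto.
apply (is_derive_on_cont I _ t _ It (D 0%nat t It)).
Qed.

(** Places a compact segment, on which integration is possible, between two relative neighbourhoods
    of [y0]. On each side the segment ends at a point of [I] within [d/2], or at [y0] when [I] has
    no point on that side. *)
Lemma near_in_compact I y0 d :
  real_interval I -> I y0 -> 0 < d ->
  exists delta a b, 0 < delta /\ a <= b /\
    subset (near_in I y0 delta) (fun t => a <= t <= b) /\
    subset (fun t => a <= t <= b) (near_in I y0 d).
Proof.
intros [K _] I0 dp.
assert (L : exists e, 0 < e <= d / 2 /\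
  exists a, I a /\ y0 - d / 2 <= a <= y0 /\ forall t, I t -> y0 - e < t -> a <= t).
{ destruct (classic (exists a, I a /\ a < y0)) as [[a [Ia La]]|N].
  - assert (M := Rmax_l a (y0 - d / 2)). assert (M' := Rmax_r a (y0 - d / 2)).
    assert (Rmax a (y0 - d / 2) < y0) by (apply Rmax_lub_lt; lra).
    exists (y0 - Rmax a (y0 - d / 2)). split. lra.
    exists (Rmax a (y0 - d / 2)). split. apply (K a y0); auto. lra.
    split. lra. intros; lra.
  - exists (d / 2). split. lra. exists y0. split; auto. split. lra.
    intros t It _. apply Rnot_lt_le. intros Lt. eauto. }
assert (U : exists e, 0 < e <= d / 2 /\
  exists b, I b /\ y0 <= b <= y0 + d / 2 /\ forall t, I t -> t < y0 + e -> t <= b).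
{ destruct (classic (exists b, I b /\ y0 < b)) as [[b [Ib Lb]]|N].
  - assert (M := Rmin_l b (y0 + d / 2)). assert (M' := Rmin_r b (y0 + d / 2)).
    assert (y0 < Rmin b (y0 + d / 2)) by (apply Rmin_glb_lt; lra).
    exists (Rmin b (y0 + d / 2) - y0). split. lra.
    exists (Rmin b (y0 + d / 2)). split. apply (K y0 b); auto. lra.
    split. lra. intros; lra.
  - exists (d / 2). split. lra. exists y0. split; auto. split. lra.
    intros t It _. apply Rnot_lt_le. intros Lt. eauto. }
destruct L as [e1 [H1 [a [Ia [Ha La]]]]], U as [e2 [H2 [b [Ib [Hb Lb]]]]].
assert (M := Rmin_l e1 e2). assert (M' := Rmin_r e1 e2).
exists (Rmin e1 e2), a, b. split. apply Rmin_pos; lra. split. lra. split.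
- intros t [It Ht]. apply Rabs_def2 in Ht. split. apply La; auto; lra. apply Lb; auto; lra.
- intros t Ht. split. apply (K a b); auto. apply Rabs_def1; lra.
Qed.

(** * Branches of the algebraic equation as level sets of the first integral *)

Lemma theta_branch_subset sigma S f g h (J J' : R -> Prop) K0 theta :
  subset J' J -> theta_branch sigma S f g h J K0 theta ->
  theta_branch sigma S f g h J' K0 theta.
Proof.
intros JJ [C H]. split. exact (continuous_on_subset J J' theta JJ C). auto.
Qed.

Lemma theta_branch_first_integral sigma S f g h rho E J K0 theta :
  real_interval J -> K0 <> RtoC 0 ->
  (forall y, J y -> rho y <> 0 /\ sigma * (h y / root_disc f g h y) = / rho y) ->
  (forall a, a ^ 2 + a + S <> 0 ->
      exists c : C, c <> RtoC 0 /\
      forall z, (forall t, Rmin a z <= t <= Rmax a z -> t ^ 2 + t + S <> 0) ->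
        eG z S = (c * RtoC (E z))%C) ->
  theta_branch sigma S f g h J K0 theta ->
  exists kappa, forall y, J y ->
    cubic S (theta y) <> 0 /\ E (theta y) * rho y = kappa.
Proof.
intros HJ K00 Hr HE [C H]. destruct (proj2 HJ) as [y0 [_ [J0 _]]].
destruct (HE (theta y0)) as [c [c0 Hc]]. { apply H; auto. }
(* With [eG = c E] the algebraic equation reads [E (theta) rho = K0 / c]; this number is therefore
   real, and [fst] loses nothing. *)
exists (fst (K0 / c)%C). intros y Jy. destruct (Hr y Jy) as [R0 Er].
destruct (H y Jy) as [Q0 EG]. rewrite Er in EG.
assert (Rc : RtoC (rho y) <> RtoC 0) by (intros Z; injection Z; auto).
split.
- apply Rmult_integral_contrapositive_currified; auto. intros Z.
  rewrite Z, eG_0, Cmult_0_r in EG. injection EG as EG.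
  symmetry in EG. revert EG. apply Rinv_neq_0_compat. auto.
- rewrite Hc in EG.
  2:{ intros t Ht. apply (path_avoids J (fun z => z ^ 2 + z + S <> 0) theta y0 y); auto.
      intros; apply H; auto. }
  rewrite RtoC_inv in EG by auto.
  assert (EE : RtoC (E (theta y) * rho y) = (K0 / c)%C).
  { rewrite RtoC_mult.
    replace (RtoC (E (theta y))) with (/ K0 * (c * RtoC (E (theta y))) * (K0 / c))%C
      by (field; auto).
    rewrite EG. field. auto. }
  rewrite <- EE. reflexivity.
Qed.

Lemma theta_branch_of_first_integral sigma S f g h rho E J theta kappa :
  real_interval J ->
  (forall y, J y -> rho y <> 0 /\ sigma * (h y / root_disc f g h y) = / rho y) ->
  (forall a, a ^ 2 + a + S <> 0 ->
      exists c : C, c <> RtoC 0 /\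
      forall z, (forall t, Rmin a z <= t <= Rmax a z -> t ^ 2 + t + S <> 0) ->
        eG z S = (c * RtoC (E z))%C) ->
  continuous_on J theta -> kappa <> 0 ->
  (forall y, J y -> cubic S (theta y) <> 0 /\ E (theta y) * rho y = kappa) ->
  exists K0 : C, K0 <> RtoC 0 /\ theta_branch sigma S f g h J K0 theta.
Proof.
intros HJ Hr HE C k0 H. destruct (proj2 HJ) as [y0 [_ [J0 _]]].
assert (Q : forall y, J y -> theta y ^ 2 + theta y + S <> 0).
{ intros y Jy. apply cubic_neq_0. apply H; auto. }
destruct (HE (theta y0) (Q y0 J0)) as [c [c0 Hc]].
assert (kc : RtoC kappa <> RtoC 0) by (intros Z; injection Z; auto).
(* The factor [c] cancels in [c E / K0], leaving [E / kappa = 1 / rho]. *)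
exists (c * RtoC kappa)%C. split. apply Cmult_neq_0; auto.
split. exact C. intros y Jy. split. exact (Q y Jy).
destruct (Hr y Jy) as [R0 ->].
assert (Rc : RtoC (rho y) <> RtoC 0) by (intros Z; injection Z; auto).
rewrite Hc.
2:{ intros t Ht. apply (path_avoids J (fun z => z ^ 2 + z + S <> 0) theta y0 y); auto. }
rewrite RtoC_inv by auto. destruct (H y Jy) as [_ Ek].
rewrite <- Ek, RtoC_mult in kc |- *.
field. repeat split; auto. intros Z. apply kc. rewrite Z. ring.
Qed.

Theorem theorem2 :
  forall (I : R -> Prop) (f g h k vp H : R -> R) (sigma S C0 : R),
    real_interval I ->
    smooth_on I f -> smooth_on I g -> smooth_on I h -> smooth_on I k ->
    (forall y, I y -> h y <> 0) ->
    sigma = 1 \/ sigma = -1 ->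
    abel_solution f g h k I I vp ->
    (forall y, I y -> 3 * h y * vp y ^ 2 + 2 * g y * vp y + f y = 0) ->
    (forall y, I y ->
       vp y = - g y / (3 * h y) + sigma * (root_disc f g h y / (3 * h y))) ->
    S <> 0 ->
    antiderivative_on I H h ->
    (forall y, I y ->
       6 * S * H y + C0 / 3 <> 0 /\
       g y ^ 2 / (3 * h y ^ 2) - f y / h y = 1 / (6 * S * H y + C0 / 3)) ->
    (* a *)
    exactly_integrable (f :: g :: h :: k :: nil) I (abel_solution f g h k I)
    /\
    (* b *)
    ((forall (J : R -> Prop) (v : R -> R),
        real_interval J -> subset J I ->
        (abel_solution f g h k I J v /\
         (forall y, J y -> abel_admissible sigma S f g h vp y (v y))
         <-> abel_family sigma S f g h vp J v)) /\
     (forall y0 v0,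
        I y0 -> abel_admissible sigma S f g h vp y0 v0 ->
        exists (delta : R) (v : R -> R),
          0 < delta /\
          abel_family sigma S f g h vp (near_in I y0 delta) v /\
          v y0 = v0))
    /\
    (* c *)
    (exactly_integrable (f :: g :: h :: k :: nil) I
       (lienard_regular_solution f g h k I) /\
     (forall (X : R -> Prop) (y : R -> R),
        real_interval X ->
        ((exists y1,
            lienard_solution f g h k I X y y1 /\
            forall x, X x ->
              y1 x <> 0 /\ abel_admissible sigma S f g h vp (y x) (/ y1 x))
         <-> lienard_family sigma S f g h I X y)) /\
     (forall x1 y0 p0,
        I y0 -> p0 <> 0 -> abel_admissible sigma S f g h vp y0 (/ p0) ->
        exists (delta : R) (X : R -> Prop) (y : R -> R),
          0 < delta /\ real_interval X /\ X x1 /\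
          (forall t, near_in I y0 delta t <-> exists x, X x /\ y x = t) /\
          lienard_family sigma S f g h I X y /\
          y x1 = y0 /\ is_derive_on X y x1 p0)).
Proof.
intros I f g h k vp H sigma S C0 HI Sf Sg Sh Sk h0 Hs Hvp root Evp S0 DH HW.
assert (s2 : sigma * sigma = 1) by (destruct Hs; subst; ring).
set (rho := fun y => sigma * (root_disc f g h y / h y)).
(* The root condition makes the discriminant equal to [(3 h vp + g)^2], and (star) makes it a
   nonzero multiple of [h^2]; together they give strict positivity. *)
assert (disc : forall y, I y -> 0 < g y ^ 2 - 3 * f y * h y).
{ intros y Iy. specialize (root y Iy). specialize (h0 y Iy). destruct (HW y Iy) as [W0 EW].
  assert (Ed : g y ^ 2 - 3 * f y * h y = 3 * h y ^ 2 * / (6 * S * H y + C0 / 3)).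
  { replace (/ (6 * S * H y + C0 / 3)) with (g y ^ 2 / (3 * h y ^ 2) - f y / h y)
      by (rewrite EW; field; lra). field. auto. }
  assert (Es : g y ^ 2 - 3 * f y * h y = (3 * h y * vp y + g y) ^ 2).
  { replace (f y) with (- (3 * h y * vp y ^ 2 + 2 * g y * vp y)) by lra. ring. }
  assert (P := pow2_ge_0 (3 * h y * vp y + g y)). rewrite <- Es in P.
  destruct P as [P|P]; auto. exfalso. rewrite Ed in P. symmetry in P. revert P.
  repeat apply Rmult_integral_contrapositive_currified; auto; try lra.
  apply Rinv_neq_0_compat; auto. }
assert (r0 : forall y, I y -> root_disc f g h y <> 0).
{ intros y Iy. apply Rgt_not_eq, sqrt_lt_R0, disc, Iy. }
assert (r2 : forall y, I y -> root_disc f g h y ^ 2 = g y ^ 2 - 3 * f y * h y).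
{ intros y Iy. apply pow2_sqrt. left; auto. }
assert (s0 : sigma <> 0) by (intros Z; rewrite Z in s2; lra).
assert (rho0 : forall y, I y -> rho y <> 0).
{ intros y Iy. unfold rho, Rdiv.
  repeat apply Rmult_integral_contrapositive_currified; auto.
  apply Rinv_neq_0_compat; auto. }
assert (rho_inv : forall y, I y -> sigma * (h y / root_disc f g h y) = / rho y).
{ intros y Iy. unfold rho.
  replace (sigma * (h y / root_disc f g h y)) with
    (sigma * sigma * (/ (sigma * (root_disc f g h y / h y)))) by (field; auto).
  rewrite s2. ring. }
assert (Erho : forall y, I y -> rho y = 3 * vp y + g y / h y).
{ intros y Iy. rewrite Evp by auto. unfold rho. field. auto. }
assert (Crho : continuous_on I rho).
{ apply cont_at_continuous_on. intros y Iy.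
  apply (cont_at_ext I (fun y => 3 * vp y + g y * / h y)); auto.
  { intros t It. rewrite Erho; auto. }
  apply cont_at_plus; apply cont_at_mult.
  - apply cont_at_const.
  - apply (is_derive_on_cont I _ y _ Iy (proj2 Hvp y Iy)).
  - apply (smooth_on_cont I g Sg y Iy).
  - apply cont_at_inv; auto. apply (smooth_on_cont I h Sh y Iy). }
assert (rho2 : forall y, I y -> rho y * rho y = 3 * / (6 * S * H y + C0 / 3)).
{ intros y Iy. destruct (HW y Iy) as [W0 EW].
  replace (/ (6 * S * H y + C0 / 3)) with (g y ^ 2 / (3 * h y ^ 2) - f y / h y)
      by (rewrite EW; field; lra).
  unfold rho.
  replace (sigma * (root_disc f g h y / h y) * (sigma * (root_disc f g h y / h y)))
   with (sigma * sigma * (root_disc f g h y ^ 2) / h y ^ 2) by (field; auto).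
  rewrite s2, r2 by auto. field. auto. }
assert (red : reducible I f g h k vp rho S).
{ constructor; auto.
  - apply smooth_on_cont; auto.
  - exact (proj2 Hvp).
  (* [rho] is continuous, nonzero and satisfies [rho * rho = 3 / W] with [W = 6 S H + C0/3], hence
     is differentiable with [2 rho rho' = - 18 S h / W^2 = - 2 S h rho^4]. *)
  - intros y Iy. destruct (HW y Iy) as [W0 _].
    assert (DW := is_derive_on_scal I _ y 3 _ Iy (is_derive_on_inv I _ y _ Iy
      (is_derive_on_plus I _ _ y _ _ Iy (is_derive_on_scal I H y (6 * S) _ Iy (DH y Iy))
        (is_derive_on_const I (C0 / 3) y Iy)) W0)).
    assert (DS := is_derive_on_mult (fun _ => True) _ _ (rho y) _ _ Logic.I
      (is_derive_on_id _ (rho y) Logic.I) (is_derive_on_id _ (rho y) Logic.I)).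
    assert (M0 : 1 * rho y + rho y * 1 <> 0) by (specialize (rho0 y Iy); lra).
    assert (DD := is_derive_on_implicit I (fun _ => True) _ rho _ y _ _ Iy
      (fun _ _ => Logic.I) (Crho y Iy) DS M0 rho2 DW).
    apply (is_derive_on_eq _ _ _ _ _ _ Iy DD); auto.
    assert (EW : 6 * S * H y + C0 / 3 = 3 / (rho y * rho y)).
    { rewrite rho2 by auto. set (W := 6 * S * H y + C0 / 3) in *. field. auto. }
    cbv beta. rewrite EW. field. specialize (rho0 y Iy). split; lra. }
assert (Ia : exactly_integrable (f :: g :: h :: k :: nil) I (abel_solution f g h k I)).
{ apply (abel_integrable _ I f g h k vp rho S red); simpl; auto.
  intros J JI.
  assert (QB : forall c, In c (f :: g :: h :: k :: nil) ->
    quadrature (f :: g :: h :: k :: nil) I J c) by (intros; apply quad_base; auto).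
  simpl in QB.
  assert (Qd : quadrature (f :: g :: h :: k :: nil) I J
     (fun t => g t * (g t * 1) + -3 * (f t * h t))).
  { repeat first [apply quad_plus | apply quad_mult | apply quad_const]; auto. }
  apply quad_ext with
    (a := fun t => sigma * (sqrt (g t * (g t * 1) + -3 * (f t * h t)) * / h t)).
  - intros t Jt. unfold rho, root_disc. f_equal. unfold Rdiv. f_equal. f_equal. simpl; ring.
  - apply quad_mult. apply quad_const. apply quad_mult; [|apply quad_inv; auto].
    apply quad_sqrt; auto. intros t Jt. specialize (disc t (JI t Jt)). simpl in disc. lra. }
destruct (eG_real_form S) as [E [DE HE]].
assert (Hr : forall J : R -> Prop, subset J I -> forall y, J y ->
  rho y <> 0 /\ sigma * (h y / root_disc f g h y) = / rho y) by (intros J JI y Jy; auto).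
assert (form : forall z y, abel_formula sigma f g h vp z y = rho y * z + vp y).
{ intros. reflexivity. }
(* The formula for [vp] says [sigma * root_disc - g = 3 h vp]. *)
assert (integrand : forall z y, I y ->
  lienard_integrand sigma f g h z y = 3 * abel_formula sigma f g h vp z y).
{ intros z y Iy. unfold lienard_integrand, abel_formula. rewrite Evp by auto. field. auto. }
assert (adm : forall z y, cubic S z <> 0 ->
  abel_admissible sigma S f g h vp y (abel_formula sigma f g h vp z y)).
{ intros z y Hz. exists z. split; auto. apply cubic_neq_0; auto. }
assert (Ib : forall (J : R -> Prop) (v : R -> R),
        real_interval J -> subset J I ->
        (abel_solution f g h k I J v /\
         (forall y, J y -> abel_admissible sigma S f g h vp y (v y))
         <-> abel_family sigma S f g h vp J v)).
{ intros J v HJ JI. split.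
  - intros [HV HA]. assert (D := abel_to_theta red J v HV).
    assert (N : forall y, J y -> cubic S ((v y - vp y) / rho y) <> 0).
    { intros y Jy. destruct (HA y Jy) as [z [-> [z0 Q0]]]. rewrite form.
      replace ((rho y * z + vp y - vp y) / rho y) with z by (field; auto).
      apply Rmult_integral_contrapositive_currified; auto. }
    destruct (theta_first_integral red DE J _ HJ JI D N) as [kappa [k0 Hk]].
    destruct (theta_branch_of_first_integral sigma S f g h rho E J _ kappa HJ (Hr J JI)
      HE (antiderivative_cont _ _ _ D) k0) as [K0 [K00 B]]. { auto. }
    exists K0, (fun y => (v y - vp y) / rho y). split; [exact K00 | split; [exact B|]].
    intros y Jy. rewrite form. field. auto.
  - intros [K0 [theta [K00 [B Ev]]]].
    destruct (theta_branch_first_integral sigma S f g h rho E J K0 theta HJ K00 (Hr J JI)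
      HE B) as [kappa Hk].
    assert (D := theta_from_first_integral red DE J theta kappa JI (proj1 B)
      (fun y Jy => proj1 (Hk y Jy)) (fun y Jy => proj2 (Hk y Jy))).
    split.
    + destruct (theta_to_abel red J theta JI D) as [_ DV]. split; auto.
      intros y Jy. apply (is_derive_on_eq _ _ _ _ _ _ Jy (DV y Jy)); auto.
      intros t Jt. rewrite Ev by auto. reflexivity.
      rewrite !Ev by auto. reflexivity.
    + intros y Jy. rewrite Ev by auto. apply adm. apply Hk; auto. }
assert (Ib' : forall y0 v0,
        I y0 -> abel_admissible sigma S f g h vp y0 v0 ->
        exists (delta : R) (v : R -> R),
          0 < delta /\
          abel_family sigma S f g h vp (near_in I y0 delta) v /\
          v y0 = v0).
{ intros y0 v0 I0 [z0 [Ez0 [z00 Q0]]].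
  assert (c0 : cubic S z0 <> 0) by (apply Rmult_integral_contrapositive_currified; auto).
  destruct (first_integral_local red DE y0 z0 I0 c0) as [delta [theta [dp [C [Hk Et]]]]].
  destruct (theta_branch_of_first_integral sigma S f g h rho E (near_in I y0 delta) theta
    (E z0 * rho y0)) as [K0 [K00 B]]; auto.
  - apply real_interval_near_in; auto.
  - apply Hr. apply near_in_subset.
  - apply Rmult_integral_contrapositive_currified; auto. apply DE; auto.
  - exists delta, (fun y => abel_formula sigma f g h vp (theta y) y).
    split. auto. split. exists K0, theta. auto. rewrite Et. auto. }
split. exact Ia. split. split. exact Ib. exact Ib'.
split. apply lienard_integrable; exact Ia.
split.
{ intros X y HX. split.
  - intros [y1 [HL Hy1]].
    assert (N : forall x, X x -> y1 x <> 0) by (intros; apply Hy1; auto).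
    destruct (lienard_to_abel f g h k I X y y1 HX HL N) as [xi [HJ [Hxi [Dxi HV]]]].
    assert (JI := proj1 HV).
    assert (HA : forall t, image X y t -> abel_admissible sigma S f g h vp t (/ y1 (xi t))).
    { intros t [x [Xx <-]]. rewrite Hxi by auto. apply Hy1; auto. }
    destruct (proj1 (Ib _ _ HJ JI) (conj HV HA)) as [K0 [theta [K00 [B Ev]]]].
    assert (IX : forall x, X x -> image X y (y x)) by (intros x Xx; exists x; auto).
    (* The inverse function [xi] is an antiderivative of [v] with [xi (y x) = x]; its additive
       constant already accounts for [x0]. *)
    exists K0, 0, (image X y), theta, (fun t => 3 * xi t).
    repeat (split; [assumption|]). split; [|split].
    + intros t Jt.
      apply (is_derive_on_eq _ _ _ _ _ _ Jt
        (is_derive_on_scal _ _ t 3 _ Jt (Dxi t Jt))); auto.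
      rewrite integrand by auto. rewrite <- Ev by auto. reflexivity.
    + destruct HL as [y2 HL]. intros x Xx. apply (is_derive_on_cont X y x (y1 x)); auto.
      apply HL; auto.
    + intros x Xx. split; auto. rewrite integrand by auto. rewrite <- Ev by auto.
      rewrite Hxi by auto. split. 2: field.
      assert (/ y1 x <> 0) by (apply Rinv_neq_0_compat; auto). lra.
  - intros [K0 [x0 [J [theta [P [K00 [HJ [JI [B [DP [C HP]]]]]]]]]]].
    set (v := fun t => abel_formula sigma f g h vp (theta t) t).
    destruct (proj2 (Ib J v HJ JI)) as [HV HA]. { exists K0, theta. auto. }
    exists (fun x => / v (y x)).
    assert (v0 : forall x, X x -> v (y x) <> 0).
    { intros x Xx. destruct (HP x Xx) as [Jy [N _]]. rewrite integrand in N by auto.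
      unfold v. lra. }
    split.
    + apply (abel_to_lienard f g h k I J v (fun t => 1 / 3 * P t) X y x0); auto.
      * intros t Jt.
        apply (is_derive_on_eq _ _ _ _ _ _ Jt
          (is_derive_on_scal _ _ t (1 / 3) _ Jt (DP t Jt))); auto.
        rewrite integrand by auto. unfold v. field.
      * intros x Xx. destruct (HP x Xx) as [Jy [_ EP]]. repeat split; auto.
    + intros x Xx. split. apply Rinv_neq_0_compat; auto. rewrite Rinv_inv.
      apply HA. apply HP; auto. }
intros x1 y0 p0 I0 p00 HA.
destruct (Ib' y0 _ I0 HA) as [d0 [v [d0p [HF Ev0]]]].
assert (HN0 := real_interval_near_in I y0 d0 HI I0 d0p).
assert (N0I := near_in_subset I y0 d0).
destruct (proj2 (Ib _ v HN0 N0I) HF) as [[_ DV] _].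
assert (CV := antiderivative_cont _ v _ DV).
destruct HF as [K0 [theta [K00 [B Ev]]]].
assert (v0 : v y0 <> 0) by (rewrite Ev0; apply Rinv_neq_0_compat; auto).
assert (Ny0 : forall d, 0 < d -> near_in I y0 d y0).
{ intros d dp. split; auto. rewrite Rminus_diag_eq, Rabs_R0; auto. }
(* Within [d1] of [y0] the function [v] cannot vanish, as [y' = 1 / v] requires. *)
destruct (proj1 (cont_at_iff _ _ _) (CV y0 (Ny0 d0 d0p)) (Rabs (v y0))) as [d1 [d1p Hd1]].
{ apply Rabs_pos_lt; auto. }
assert (M := Rmin_l d0 d1). assert (M' := Rmin_r d0 d1).
assert (Mp : 0 < Rmin d0 d1) by (apply Rmin_pos; auto).
destruct (near_in_compact I y0 (Rmin d0 d1) HI I0 Mp) as [delta [a [b [dp [ab [SN SN']]]]]].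
assert (SN0 : subset (fun t => a <= t <= b) (near_in I y0 d0)).
{ intros t Ht. destruct (SN' t Ht). split; auto. lra. }
assert (vn : forall t, a <= t <= b -> v t <> 0).
{ intros t Ht Z. specialize (Hd1 t (SN0 t Ht)). destruct (SN' t Ht) as [_ L].
  rewrite Z, Rminus_0_l, Rabs_Ropp in Hd1. lra. }
destruct (antiderivative_exists _ a b v ab SN0 CV) as [P DP].
set (N := near_in I y0 delta) in *.
assert (HN : real_interval N) by (apply real_interval_near_in; auto).
assert (NN0 : subset N (near_in I y0 d0)) by (intros t Ht; auto).
assert (NI : subset N I) by (intros t Ht; apply Ht).
(* The travel time, normalised by [T y0 = x1]; the required [y] is its inverse. *)
set (T := fun t => P t + (x1 - P y0)).
assert (DT : antiderivative_on N T v).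
{ intros t Nt.
  apply (is_derive_on_eq _ _ _ _ _ _ Nt (is_derive_on_plus _ _ _ t _ _ Nt
    (is_derive_on_subset _ _ _ _ _ SN Nt (DP t (SN t Nt)))
    (is_derive_on_const _ (x1 - P y0) t Nt))); auto. ring. }
assert (vN : forall t, N t -> v t <> 0) by (intros; apply vn; auto).
destruct (inverse_function N T v HN DT (continuous_on_subset _ _ _ NN0 CV) vN)
  as [y [HX [HG [CG DG]]]].
assert (Ny : N y0) by (apply Ny0; auto).
assert (T0 : T y0 = x1) by (unfold T; ring).
assert (Xx1 : image N T x1) by (exists y0; auto).
assert (Yx1 : y x1 = y0) by (rewrite <- T0; exact (HG y0 Ny)).
assert (GX : forall x, image N T x -> N (y x) /\ T (y x) = x).
{ intros x [t [Nt <-]]. rewrite HG; auto. }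
exists delta, (image N T), y.
split; [exact dp | split; [exact HX | split; [exact Xx1 | split; [|split; [|split]]]]].
- intros t. split.
  + intros Nt. exists (T t). split; auto. exists t; auto.
  + intros [x [Xx <-]]. apply GX; auto.
- exists K0, x1, N, theta, (fun t => 3 * (P t + - P y0)).
  split; [exact K00 | split; [exact HN | split; [exact NI | split; [|split; [|split]]]]].
  + apply (theta_branch_subset _ _ _ _ _ (near_in I y0 d0)); auto.
  + intros t Nt.
    assert (DD := is_derive_on_scal N _ t 3 _ Nt (is_derive_on_plus _ _ _ t _ _ Nt
      (is_derive_on_subset _ _ _ _ _ SN Nt (DP t (SN t Nt)))
      (is_derive_on_const _ (- P y0) t Nt))).
    apply (is_derive_on_eq _ _ _ _ _ _ Nt DD); auto.
    rewrite integrand, <- Ev by auto. ring.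
  + exact CG.
  + intros x Xx. destruct (GX x Xx) as [Nx Tx]. split; auto.
    rewrite integrand, <- Ev by auto. split.
    * specialize (vN _ Nx). lra.
    * unfold T in Tx. lra.
- exact Yx1.
- apply (is_derive_on_eq _ _ _ _ _ _ Xx1 (DG x1 Xx1)); auto.
  rewrite Yx1, Ev0, Rinv_inv. reflexivity.
Qed.
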